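(* Let $A$ be a bounded linear operator in a right quaternionic Hilbert space $\mathcal H$ such that $A+A^*$ has finite rank $m$, and write $A+A^*=-CJC^*$, where $J\in\mathbb H^{m\times m}$ is a real signature matrix and $C$ is a bounded linear operator from $\mathbb H^m$ into $\mathcal H$; assume the pair $(C^*,A)$ is observable. Then the characteristic operator function of $A$, $$S(p)=I-p\,C^*\star(I-pA)^{-\star}CJ ,$$ belongs to $\mathcal S_0(J,J)$.
   Context: $\mathbb H$: quaternions; $\mathbb S$: purely imaginary unit quaternions; $\mathbb C_I=\mathbb R+I\mathbb R$; $[x+Iy]=\{x+Jy:J\in\mathbb S\}$; $\mathbb H_+=\{\mathrm{Re}\,p>0\}$. An s-domain is a domain $\Omega\subseteq\mathbb H$ meeting $\mathbb R$ with each $\Omega\cap\mathbb C_I$ a domain; axially symmetric means $q\in\Omega\Rightarrow[q]\subset\Omega$. A matrix- or operator-valued function is left slice hyperholomorphic if it is real differentiable and $(\partial_x+I\partial_y)f(x+Iy)=0$ on each $\Omega\cap\mathbb C_I$; right slice hyperholomorphic with $I$ on the right. A real signature matrix is one unitarily equivalent to $\mathrm{diag}(I_+,-I_-)$ (so $J=J^*=J^{-1}$). A pair $(G,A)$ is observable if $\bigcap_{n\ge0}\ker GA^n=\{0\}$. The expression $C^*\star(I-pA)^{-\star}CJ$ denotes the slice hyperholomorphic extension of $C^*(I-xA)^{-1}CJ$ ($x$ real), i.e. $(C^*-\bar p\,C^*A)(I-2\mathrm{Re}(p)A+|p|^2A^2)^{-1}CJ$. $S\in\mathcal S_0(J,J)$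 means: in an axially symmetric s-domain $\Omega\subset\mathbb H_+$ intersecting the positive real axis in which $S$ is defined (the dependence on $\Omega$ is suppressed), the kernel $K_S(p,q)=Jk(p,q)-S(p)\star k(p,q)\star_rJS(q)^*$ is positive definite, where $k(p,q)=(\bar p+\bar q)(|p|^2+2\mathrm{Re}(p)\bar q+\bar q^2)^{-1}$. $K_S$ is the kernel left slice hyperholomorphic in $p$, right slice hyperholomorphic in $\bar q$, equal to $\frac{J-S(x)JS(y)^*}{x+y}$ for real $p=x$, $q=y$. Positive definite: all Hermitian matrices $(c_i^*K_S(w_i,w_j)c_j)_{i,j}$ are nonnegative. *)

(* Defs.v *)
From HB Require Import structures.
From mathcomp Require Import all_boot all_order all_algebra ring lra.
From mathcomp Require Import all_classical all_reals all_analysis.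

Set Implicit Arguments.
Unset Strict Implicit.
Unset Printing Implicit Defensive.
Import Order.TTheory GRing.Theory Num.Theory.
Import numFieldNormedType.Exports.

Local Open Scope classical_set_scope.
Local Open Scope ring_scope.

Lemma ler_sqrt_form (R : realType) (U : lmodType R) (B : U -> U -> R) :
    (forall u v w, B (u + v) w = B u w + B v w) ->
    (forall a u v, B (a *: u) v = a * B u v) ->
    (forall u v, B u v = B v u) -> (forall u, 0 <= B u u) ->
  forall u v, Num.sqrt (B (u + v) (u + v)) <= Num.sqrt (B u u) + Num.sqrt (B v v).
Proof.
move=> BD BZ BC B0 u v.
have BDr a b c : B a (b + c) = B a b + B a c by rewrite BC BD !(BC a).
have BZr a b c : B a (c *: b) = c * B a b by rewrite BC BZ BC.
have CS : B u v ^+ 2 <= B u u * B v v.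
  have P a b : 0 <= a ^+ 2 * B u u + a * b * B u v *+ 2 + b ^+ 2 * B v v.
    have := B0 (a *: u + b *: v).
    by rewrite !(BD, BDr, BZ, BZr) (BC v u); congr (_ <= _); ring.
  have := B0 u; have := B0 v; move: P.
  set x := B u u; set y := B u v; set z := B v v => P z0 x0.
  move: z0; rewrite le_eqVlt => /predU1P[z0|z0].
    rewrite -z0 in P *; have [->|y0] := eqVneq y 0; first by rewrite mulr0 expr0n.
    have := P 1 (- (x + 1) / y).
    rewrite (_ : _ + _ = - x - 2); last by field.
    lra.
  have := P z (- y).
  rewrite (_ : _ + _ = z * (x * z - y ^+ 2)); last by ring.
  by rewrite pmulr_rge0// subr_ge0.
rewrite -(@ler_pXn2r _ 2)// ?nnegrE ?addr_ge0 ?sqrtr_ge0//.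
rewrite sqrrD !sqr_sqrtr// BD !BDr (BC v u).
have : B u v <= Num.sqrt (B u u) * Num.sqrt (B v v).
  rewrite -sqrtrM// (le_trans (ler_norm _))// -sqrtr_sqr.
  by rewrite ler_sqrt// mulr_ge0.
lra.
Qed.

Record quat (R : Type) := Quat { qre : R; qi : R; qj : R; qk : R }.

Section QuatInstances.
Variable R : realType.
Implicit Types p q : quat R.

Definition qtup p := (qre p, qi p, qj p, qk p).
Definition qtupI (t : R * R * R * R) := Quat t.1.1.1 t.1.1.2 t.1.2 t.2.
Lemma qtupK : cancel qtup qtupI. Proof. by case. Qed.

HB.instance Definition _ := Choice.copy (quat R) (can_type qtupK).

Definition qzero : quat R := Quat 0 0 0 0.
Definition qone : quat R := Quat 1 0 0 0.
Definition qopp p := Quat (- qre p) (- qi p) (- qj p) (- qk p).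
Definition qadd p q :=
  Quat (qre p + qre q) (qi p + qi q) (qj p + qj q) (qk p + qk q).
Definition qmul p q := Quat
  (qre p * qre q - qi p * qi q - qj p * qj q - qk p * qk q)
  (qre p * qi q + qi p * qre q + qj p * qk q - qk p * qj q)
  (qre p * qj q - qi p * qk q + qj p * qre q + qk p * qi q)
  (qre p * qk q + qi p * qj q - qj p * qi q + qk p * qre q).
Definition qscale (x : R) p := Quat (x * qre p) (x * qi p) (x * qj p) (x * qk p).

Lemma qaddA : associative qadd.
Proof. by case=> ????[????][????]; congr Quat => /=; ring. Qed.
Lemma qaddC : commutative qadd.
Proof. by case=> ????[????]; congr Quat => /=; ring. Qed.
Lemma qadd0 : left_id qzero qadd.
Proof. by case=> ????; congr Quat => /=; ring. Qed.
Lemma qaddN : left_inverse qzero qopp qadd.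
Proof. by case=> ????; congr Quat => /=; ring. Qed.
HB.instance Definition _ := GRing.isZmodule.Build (quat R) qaddA qaddC qadd0 qaddN.

Lemma qmulA : associative qmul.
Proof. by case=> ????[????][????]; congr Quat => /=; ring. Qed.
Lemma qmul1 : left_id qone qmul.
Proof. by case=> ????; congr Quat => /=; ring. Qed.
Lemma qmulr1 : right_id qone qmul.
Proof. by case=> ????; congr Quat => /=; ring. Qed.
Lemma qmulDl : left_distributive qmul +%R.
Proof. by case=> ????[????][????]; congr Quat => /=; ring. Qed.
Lemma qmulDr : right_distributive qmul +%R.
Proof. by case=> ????[????][????]; congr Quat => /=; ring. Qed.
Lemma qone_neq0 : qone != 0.
Proof. by apply/eqP => -[] /eqP; rewrite oner_eq0. Qed.
HB.instance Definition _ :=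
  GRing.Zmodule_isNzRing.Build (quat R) qmulA qmul1 qmulr1 qmulDl qmulDr qone_neq0.

Lemma qscaleA x y p : qscale x (qscale y p) = qscale (x * y) p.
Proof. by congr Quat => /=; ring. Qed.
Lemma qscale1 : left_id 1 qscale.
Proof. by case=> ????; congr Quat => /=; ring. Qed.
Lemma qscaleDr : right_distributive qscale +%R.
Proof. by move=> x p q; congr Quat => /=; ring. Qed.
Lemma qscaleDl p : {morph qscale^~ p : x y / x + y}.
Proof. by move=> x y; congr Quat => /=; ring. Qed.
HB.instance Definition _ :=
  GRing.Zmodule_isLmodule.Build R (quat R) qscaleA qscale1 qscaleDr qscaleDl.

Definition qinner p q := qre p * qre q + qi p * qi q + qj p * qj q + qk p * qk q.
Definition qnorm p := Num.sqrt (qinner p p).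

Lemma qinner_ge0 p : 0 <= qinner p p.
Proof. by rewrite /qinner -!expr2 !addr_ge0 ?sqr_ge0. Qed.
Lemma qinner_eq0 p : qinner p p = 0 -> p = 0.
Proof.
rewrite /qinner -!expr2; case: p => a b c d /= h.
have := sqr_ge0 a; have := sqr_ge0 b; have := sqr_ge0 c; have := sqr_ge0 d.
move=> d0 c0 b0 a0.
by congr Quat; apply/eqP; rewrite -sqrf_eq0; apply/eqP; lra.
Qed.
Lemma qnormD p q : qnorm (p + q) <= qnorm p + qnorm q.
Proof.
apply: (@ler_sqrt_form R (quat R) qinner).
- by move=> *; rewrite /qinner /=; ring.
- by move=> *; rewrite /qinner /=; ring.
- by move=> *; rewrite /qinner /=; ring.
- exact: qinner_ge0.
Qed.
Lemma qnormZ x p : qnorm (x *: p) = `|x| * qnorm p.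
Proof.
rewrite /qnorm -sqrtr_sqr -sqrtrM ?sqr_ge0//; congr Num.sqrt.
by rewrite /qinner /=; ring.
Qed.
Lemma qnorm0_eq0 p : qnorm p = 0 -> p = 0.
Proof.
move=> /eqP; rewrite sqrtr_eq0 => p0; apply: qinner_eq0.
by apply/eqP; rewrite eq_le p0 qinner_ge0.
Qed.
HB.instance Definition _ := @Lmodule_isNormed.Build R (quat R)
  qnorm qnormD qnormZ qnorm0_eq0.

Definition qconj p := Quat (qre p) (- qi p) (- qj p) (- qk p).
Definition qreal (x : R) : quat R := Quat x 0 0 0.

Definition qunit : pred (quat R) := [pred p | p != 0].
Definition qinv p := if p == 0 then p else (qinner p p)^-1 *: qconj p.
Lemma qmulVr : {in qunit, left_inverse 1 qinv *%R}.
Proof.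
move=> p; rewrite unfold_in /= => p0; rewrite /qinv (negbTE p0).
have : qinner p p != 0 by apply: contra p0 => /eqP/qinner_eq0->.
by rewrite /qinner => n0; congr Quat => /=; field.
Qed.
Lemma qmulrV : {in qunit, right_inverse 1 qinv *%R}.
Proof.
move=> p; rewrite unfold_in /= => p0; rewrite /qinv (negbTE p0).
have : qinner p p != 0 by apply: contra p0 => /eqP/qinner_eq0->.
by rewrite /qinner => n0; congr Quat => /=; field.
Qed.
Lemma qunitP p q : q * p = 1 /\ p * q = 1 -> qunit p.
Proof.
by case=> qp _; rewrite /qunit /=; apply/eqP => p0; move/eqP: qp; rewrite p0 mulr0 eq_sym oner_eq0.
Qed.
Lemma qinv_out : {in [predC qunit], qinv =1 id}.
Proof. by move=> p; rewrite !unfold_in /= negbK /qinv => ->. Qed.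
HB.instance Definition _ := GRing.NzRing_hasMulInverse.Build (quat R)
  qmulVr qmulrV qunitP qinv_out.

End QuatInstances.

Notation "x %:H" := (qreal x) (at level 1, format "x %:H")
  : ring_scope.

(* The inner product is linear in its first argument:
   <u a, v> = <u, v> a and <v, u> = conj <u, v>. *)

HB.mixin Record NormedModule_isRightQuatInner (R : realType) V
    & NormedModule R V := {
  rscale : V -> quat R -> V;
  rscaleA : forall v a b, rscale (rscale v a) b = rscale v (a * b);
  rscaleDl : forall u v a, rscale (u + v) a = rscale u a + rscale v a;
  rscaleDr : forall v a b, rscale v (a + b) = rscale v a + rscale v b;
  rscale_real : forall v (x : R), rscale v x%:H = x *: v;
  qdot : V -> V -> quat R;
  qdotDl : forall u v w, qdot (u + v) w = qdot u w + qdot v w;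
  qdotZl : forall u a w, qdot (rscale u a) w = qdot u w * a;
  qdotC : forall u v, qdot v u = qconj (qdot u v);
  qdot_norm : forall v, qre (qdot v v) = `|v| ^+ 2
}.

#[short(type="rqInnerType")]
HB.structure Definition RightQuatInner (R : realType) :=
  {V of NormedModule R V & NormedModule_isRightQuatInner R V}.

#[short(type="rqHilbertType")]
HB.structure Definition RightQuatHilbert (R : realType) :=
  {V of RightQuatInner R V & Complete V}.

Notation "v :* a" := (rscale v a) : ring_scope.

(* For M : 'M[quat R]_(m, n), the library's [a *: M] is entrywise multiplication
   by a on the left. *)

Definition mxrscale (R : realType) m n (M : 'M[quat R]_(m, n)) (a : quat R) :=
  M *m a%:M.

Definition mxadj (R : realType) m n (M : 'M[quat R]_(m, n)) : 'M[quat R]_(n, m) :=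
  (map_mx (@qconj R) M)^T.

(* [H^m] as a right inner product space: <c, d> = d^* c. An alias of the type of
   column vectors is needed, since the latter is already a left module over the
   quaternions. *)
Definition qvec (R : realType) m := 'cV[quat R]_m.

Section QvecInstances.
Variables (R : realType) (m : nat).
Implicit Types c d : qvec R m.

HB.instance Definition _ := GRing.Zmodule.copy (qvec R m) 'cV[quat R]_m.

Definition qvscale (x : R) c : qvec R m := \col_i (x *: c i 0).
Lemma qvscaleA x y c : qvscale x (qvscale y c) = qvscale (x * y) c.
Proof. by apply/colP => i; rewrite !mxE scalerA. Qed.
Lemma qvscale1 : left_id 1 qvscale.
Proof. by move=> c; apply/colP => i; rewrite !mxE scale1r. Qed.
Lemma qvscaleDr : right_distributive qvscale +%R.
Proof. by move=> x c d; apply/colP => i; rewrite !mxE scalerDr. Qed.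
Lemma qvscaleDl c : {morph qvscale^~ c : x y / x + y}.
Proof. by move=> x y; apply/colP => i; rewrite !mxE scalerDl. Qed.
HB.instance Definition _ :=
  GRing.Zmodule_isLmodule.Build R (qvec R m) qvscaleA qvscale1 qvscaleDr qvscaleDl.

Definition qvinner c d := \sum_i qinner (c i 0) (d i 0).
Definition qvnorm c := Num.sqrt (qvinner c c).
Lemma qvinner_ge0 c : 0 <= qvinner c c.
Proof. by apply: sumr_ge0 => i _; exact: qinner_ge0. Qed.
Lemma qvnormD c d : qvnorm (c + d) <= qvnorm c + qvnorm d.
Proof.
apply: (@ler_sqrt_form R (qvec R m) qvinner).
- move=> u v w; rewrite /qvinner -big_split; apply: eq_bigr => i _.
  by rewrite mxE /qinner /=; ring.
- move=> a u v; rewrite /qvinner mulr_sumr; apply: eq_bigr => i _.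
  by rewrite mxE /qinner /=; ring.
- by move=> u v; apply: eq_bigr => i _; rewrite /qinner; ring.
- exact: qvinner_ge0.
Qed.
Lemma qvnormZ x c : qvnorm (x *: c) = `|x| * qvnorm c.
Proof.
rewrite /qvnorm -sqrtr_sqr -sqrtrM ?sqr_ge0//; congr Num.sqrt.
rewrite /qvinner mulr_sumr; apply: eq_bigr => i _.
by rewrite mxE /qinner /=; ring.
Qed.
Lemma qvnorm0_eq0 c : qvnorm c = 0 -> c = 0.
Proof.
move=> /eqP; rewrite sqrtr_eq0 => c0.
have {}c0 : qvinner c c = 0 by apply/eqP; rewrite eq_le c0 qvinner_ge0.
apply/colP => i; rewrite mxE; apply: qinner_eq0.
have /psumr_eq0P := c0; apply => // j _; exact: qinner_ge0.
Qed.
HB.instance Definition _ := @Lmodule_isNormed.Build R (qvec R m)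
  qvnorm qvnormD qvnormZ qvnorm0_eq0.

Definition qvrscale c (a : quat R) : qvec R m := mxrscale c a.
Definition qvdot c d : quat R := (mxadj d *m c) 0 0.

Lemma qvrscaleE c a i : qvrscale c a i 0 = c i 0 * a.
Proof. by rewrite /qvrscale /mxrscale mxE big_ord1 !mxE eqxx. Qed.
Lemma qvrscaleA c a b : qvrscale (qvrscale c a) b = qvrscale c (a * b).
Proof. by apply/colP => i; rewrite !qvrscaleE mulrA. Qed.
Lemma qvrscaleDl c d a : qvrscale (c + d) a = qvrscale c a + qvrscale d a.
Proof. by apply/colP => i; rewrite [RHS]mxE !qvrscaleE mxE mulrDl. Qed.
Lemma qvrscaleDr c a b : qvrscale c (a + b) = qvrscale c a + qvrscale c b.
Proof. by apply/colP => i; rewrite [RHS]mxE !qvrscaleE mulrDr. Qed.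
Lemma qvrscale_real c (x : R) : qvrscale c x%:H = x *: c.
Proof.
by apply/colP => i; rewrite qvrscaleE [RHS]mxE; congr Quat => /=; ring.
Qed.
Lemma qvdotE c d : qvdot c d = \sum_i qconj (d i 0) * c i 0.
Proof. by rewrite /qvdot mxE; apply: eq_bigr => i _; rewrite !mxE. Qed.
Lemma qvdotDl u v w : qvdot (u + v) w = qvdot u w + qvdot v w.
Proof. by rewrite /qvdot mulmxDr mxE. Qed.
Lemma qvdotZl u a w : qvdot (qvrscale u a) w = qvdot u w * a.
Proof.
rewrite !qvdotE mulr_suml; apply: eq_bigr => i _.
by rewrite qvrscaleE mulrA.
Qed.
Lemma qvdotC u v : qvdot v u = qconj (qvdot u v).
Proof.
rewrite !qvdotE; elim/big_rec2: _ => [|i p q _ ->].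
  by congr Quat; rewrite /= ?oppr0.
by congr Quat => /=; ring.
Qed.
Lemma qvdot_norm v : qre (qvdot v v) = `|v| ^+ 2.
Proof.
rewrite /Num.norm /= sqr_sqrtr ?qvinner_ge0// qvdotE /qvinner.
by elim/big_rec2: _ => [//|i p q _ /= ->]; rewrite /qinner; ring.
Qed.
HB.instance Definition _ := NormedModule_isRightQuatInner.Build R (qvec R m)
  qvrscaleA qvrscaleDl qvrscaleDr qvrscale_real qvdotDl qvdotZl qvdotC qvdot_norm.

End QvecInstances.

Definition right_linear (R : realType) (U V : rqInnerType R) (T : U -> V) :=
  (forall u v, T (u + v) = T u + T v) /\ (forall u a, T (u :* a) = T u :* a).

Definition bounded_operator (R : realType) (U V : rqInnerType R) (T : U -> V) :=
  right_linear T /\ exists M : R, forall u, `|T u| <= M * `|u|.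

Definition adjoint_of (R : realType) (U V : rqInnerType R)
    (T : U -> V) (Ts : V -> U) :=
  forall u v, qdot (T u) v = qdot u (Ts v).

Definition boundedly_invertible (R : realType) (V : rqInnerType R) (T : V -> V) :=
  exists B : V -> V, [/\ bounded_operator B, cancel T B & cancel B T].

Definition op_inv (R : realType) (V : rqInnerType R) (T : V -> V) (w : V) : V :=
  xget 0 [set v | T v = w].

(* e is a basis, over the quaternions, of the range of T. *)
Definition has_rank (R : realType) (U V : rqInnerType R) (T : U -> V) (m : nat) :=
  exists e : 'I_m -> V,
    (forall a : 'I_m -> quat R, \sum_i e i :* a i = 0 -> forall i, a i = 0) /\
    range T = [set v | exists a : 'I_m -> quat R, v = \sum_i e i :* a i].

Definition observable (R : realType) (U V : rqInnerType R) (G : V -> U) (A : V -> V) :=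
  \bigcap_n [set v | G (iter n A v) = 0] = [set 0].

Definition mx_of_op (R : realType) m n (T : qvec R n -> qvec R m) : 'M[quat R]_(m, n) :=
  \matrix_(i, j) T (delta_mx j 0) i 0.

Definition unitary_mx (R : realType) m (U : 'M[quat R]_m) :=
  mxadj U *m U = 1%:M /\ U *m mxadj U = 1%:M.

(* "Real" refers to the real diagonal matrix diag(I_r, -I_(m-r)): the entries of
   J may be arbitrary quaternions. *)
Definition real_signature_mx (R : realType) m (J : 'M[quat R]_m) :=
  exists (r : nat) (U : 'M[quat R]_m), unitary_mx U /\
    J = U *m diag_mx (\row_(i < m) (if (i < r)%N then 1 else -1)) *m mxadj U.

Definition im_sphere (R : realType) : set (quat R) :=
  [set I | qre I = 0 /\ `|I| = 1].

Definition spt (R : realType) (I : quat R) (x y : R) : quat R := x%:H + I * y%:H.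

Definition domain (T : topologicalType) (D : set T) :=
  [/\ open D, connected D & D !=set0].

(* The complex line C_I is identified with R * R. *)
Definition s_domain (R : realType) (Omega : set (quat R)) :=
  [/\ domain Omega, exists x : R, Omega x%:H &
    forall I, im_sphere I -> domain [set z : R * R | Omega (spt I z.1 z.2)]].

Definition axially_symmetric (R : realType) (Omega : set (quat R)) :=
  forall I x y, im_sphere I -> Omega (spt I x y) ->
    forall I', im_sphere I' -> Omega (spt I' x y).

Definition right_half_space (R : realType) : set (quat R) := [set p | 0 < qre p].

Definition left_slice_hyperholomorphic (R : realType) m n
    (Omega : set (quat R)) (f : quat R -> 'M[quat R]_(m, n)) :=
  (forall p i j, Omega p -> differentiable (fun q => f q i j) p) /\
  (forall I x y i j, im_sphere I -> Omega (spt I x y) ->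
    derive1 (fun t : R => f (spt I t y) i j) x
      + I * derive1 (fun t : R => f (spt I x t) i j) y = 0).

(* The direction I_p of the imaginary part of p = x + I_p y, y > 0; it is 0 when
   p is real. *)
Definition im_dir (R : realType) (p : quat R) : quat R :=
  let v := p - (qre p)%:H in `|v|^-1 *: v.

(* The star product of left slice hyperholomorphic functions on an axially
   symmetric s-domain: if f(x+Iy) = a(x,y) + I b(x,y) and
   g(x+Iy) = c(x,y) + I d(x,y) for all I, then
   (f * g)(x+Iy) = (a c - b d) + I (a d + b c). At p = x + I_p y, the components
   a and b are [even_part f p] and [lodd_part f p]. *)
Definition even_part (R : realType) m n (f : quat R -> 'M[quat R]_(m, n)) p :=
  (2^-1)%:H *: (f p + f (qconj p)).

Definition lodd_part (R : realType) m n (f : quat R -> 'M[quat R]_(m, n)) p :=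
  (2^-1)%:H *: (im_dir p *: (f (qconj p) - f p)).

Definition star (R : realType) m n r (f : quat R -> 'M[quat R]_(m, n))
    (g : quat R -> 'M[quat R]_(n, r)) (p : quat R) : 'M[quat R]_(m, r) :=
  let: (a, b) := (even_part f p, lodd_part f p) in
  let: (c, d) := (even_part g p, lodd_part g p) in
  (a *m c - b *m d) + im_dir p *: (a *m d + b *m c).

(* The same for right slice hyperholomorphic functions f(x+Iy) = a(x,y) + b(x,y) I. *)
Definition rodd_part (R : realType) m n (f : quat R -> 'M[quat R]_(m, n)) p :=
  (2^-1)%:H *: mxrscale (f (qconj p) - f p) (im_dir p).

Definition rstar (R : realType) m n r (f : quat R -> 'M[quat R]_(m, n))
    (g : quat R -> 'M[quat R]_(n, r)) (p : quat R) : 'M[quat R]_(m, r) :=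
  let: (a, b) := (even_part f p, rodd_part f p) in
  let: (c, d) := (even_part g p, rodd_part g p) in
  (a *m c - b *m d) + mxrscale (a *m d + b *m c) (im_dir p).

Definition kker (R : realType) (p q : quat R) : quat R :=
  (qconj p + qconj q)
  * ((`|p| ^+ 2)%:H + (2 * qre p)%:H * qconj q + qconj q ^+ 2)^-1.

(* K_S(p, q) = J * k(p, q) - S(p) * k(p, q) *_r J S(q)^*, where the star products
   * and *_r are taken with respect to p and to conj q respectively. The first
   product is pointwise if the entries of J are real (see [star_real_cst]); in
   general it has to be a star product for K_S to be left slice hyperholomorphic
   in p. *)
Definition schur_kernel (R : realType) m (J : 'M[quat R]_m)
    (S : quat R -> 'M[quat R]_m) (p q : quat R) : 'M[quat R]_m :=
  star (fun=> J) (fun p' => (kker p' q)%:M) p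
  - star S (fun p' => rstar (fun q' => (kker p' (qconj q'))%:M)
                            (fun q' => J *m mxadj (S (qconj q'))) (qconj q)) p.

Definition nonneg_mx (R : realType) n (M : 'M[quat R]_n) :=
  mxadj M = M /\ forall z : 'cV[quat R]_n, 0 <= qre ((mxadj z *m M *m z) 0 0).

Definition positive_definite_kernel (R : realType) m (Omega : set (quat R))
    (K : quat R -> quat R -> 'M[quat R]_m) :=
  forall n (w : 'I_n -> quat R) (c : 'I_n -> 'cV[quat R]_m),
    (forall i, Omega (w i)) ->
    nonneg_mx (\matrix_(i, j) (mxadj (c i) *m K (w i) (w j) *m c j) 0 0).

Definition half_space_s_domain (R : realType) (Omega : set (quat R)) :=
  [/\ s_domain Omega, axially_symmetric Omega, Omega `<=` @right_half_space R &
    exists2 x : R, 0 < x & Omega x%:H].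

(* S belongs to S_0(J, J), where D is the set on which S is defined: there are
   axially symmetric s-domains of the half-space on which S is defined, and on
   each of them S is slice hyperholomorphic and K_S is positive definite. *)
Definition in_S0 (R : realType) m (J : 'M[quat R]_m) (D : set (quat R))
    (S : quat R -> 'M[quat R]_m) :=
  (exists Omega, half_space_s_domain Omega /\ Omega `<=` D) /\
  (forall Omega, half_space_s_domain Omega -> Omega `<=` D ->
    left_slice_hyperholomorphic Omega S /\
    positive_definite_kernel Omega (schur_kernel J S)).

Section CharacteristicFunction.
Variables (R : realType) (V : rqInnerType R) (m : nat).
Variables (A : V -> V) (C : qvec R m -> V) (Cs : V -> qvec R m) (J : 'M[quat R]_m).

Definition spencil (p : quat R) (v : V) : V :=
  v - (2 * qre p) *: A v + (`|p| ^+ 2) *: A (A v).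

(* C^* * (I - p A)^{-*} C J, where Cs is the adjoint of C *)
Definition star_resolvent (p : quat R) : 'M[quat R]_m :=
  (mx_of_op (fun c => Cs (op_inv (spencil p) (C c)))
   - qconj p *: mx_of_op (fun c => Cs (A (op_inv (spencil p) (C c))))) *m J.

Definition char_fun (p : quat R) : 'M[quat R]_m :=
  1%:M - p *: star_resolvent p.

Definition char_fun_dom : set (quat R) :=
  [set p | boundedly_invertible (spencil p)].

End CharacteristicFunction.

Section RealPoints.
Variable R : realType.

Lemma im_dir_real (x : R) : im_dir x%:H = 0.
Proof. by rewrite /im_dir subrr scaler0. Qed.

Lemma qconj_real (x : R) : qconj x%:H = x%:H.
Proof. by congr Quat; rewrite oppr0. Qed.

Lemma even_part_real m n (f : quat R -> 'M[quat R]_(m, n)) (x : R) :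
  even_part f x%:H = f x%:H.
Proof.
rewrite /even_part qconj_real -[X in X + _]scale1r -[X in _ + X]scale1r -scalerDl.
rewrite scalerA (_ : _ * _ = 1) ?scale1r//.
by congr Quat => /=; field.
Qed.

Lemma star_real m n r (f : quat R -> 'M[quat R]_(m, n))
    (g : quat R -> 'M[quat R]_(n, r)) (x : R) :
  star f g x%:H = f x%:H *m g x%:H.
Proof.
by rewrite /star /lodd_part !im_dir_real !even_part_real !scale0r !scaler0 mul0mx subr0 addr0.
Qed.

Lemma rstar_real m n r (f : quat R -> 'M[quat R]_(m, n))
    (g : quat R -> 'M[quat R]_(n, r)) (x : R) :
  rstar f g x%:H = f x%:H *m g x%:H.
Proof.
rewrite /rstar /rodd_part !im_dir_real !even_part_real /mxrscale.
by rewrite !(raddf0 scalar_mx) !mulmx0 !scaler0 mul0mx subr0 addr0.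
Qed.

Lemma kker_real (x y : R) : x + y != 0 -> kker x%:H y%:H = ((x + y)^-1)%:H.
Proof.
move=> xy0; rewrite /kker !qconj_real.
have -> : (`|x%:H| ^+ 2)%:H + (2 * qre x%:H)%:H * y%:H + y%:H ^+ 2
    = ((x + y) ^+ 2)%:H.
  rewrite /Num.norm /= /qnorm sqr_sqrtr ?qinner_ge0// /qinner /= expr2.
  by congr Quat => /=; ring.
have n0 : ((x + y) ^+ 2)%:H \is a GRing.unit.
  by rewrite unfold_in /=; apply: contra xy0 => /eqP[] /eqP; rewrite sqrf_eq0.
apply: (mulIr n0); rewrite divrK//.
by congr Quat => /=; field.
Qed.

Lemma schur_kernel_real m (J : 'M[quat R]_m) (S : quat R -> 'M[quat R]_m) (x y : R) :
  x + y != 0 ->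
  schur_kernel J S x%:H y%:H
    = ((x + y)^-1)%:H *: (J - S x%:H *m J *m mxadj (S y%:H)).
Proof.
move=> xy0; rewrite /schur_kernel !star_real !qconj_real rstar_real !qconj_real.
rewrite kker_real// mul_scalar_mx scalerBr.
have realC (t : R) (M : 'M[quat R]_m) : M *m t%:H%:M = t%:H *: M.
  apply/matrixP => i j; rewrite !mxE (bigD1 j)//= big1 ?addr0.
    by rewrite !mxE eqxx; congr Quat => /=; ring.
  by move=> k kj; rewrite !mxE (negbTE kj) mulr0.
rewrite realC; congr (_ - _).
by rewrite -[in LHS]mul_scalar_mx mulmxA realC -scalemxAl -mulmxA.
Qed.

Lemma im_dir_sqr (p : quat R) : im_dir p = 0 /\ p = (qre p)%:H \/ im_dir p ^+ 2 = -1.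
Proof.
rewrite /im_dir; set v := p - _.
have [v0|v0] := eqVneq v 0; [left|right].
  by rewrite v0 scaler0; split=> //; apply/eqP; rewrite -subr_eq0 -/v v0.
have n0 : `|v| != 0 by rewrite normr_eq0.
have nv : `|v| ^+ 2 = qi p ^+ 2 + qj p ^+ 2 + qk p ^+ 2.
  rewrite /Num.norm /= /qnorm sqr_sqrtr ?qinner_ge0// /qinner /=; ring.
have {}nv : `|v| ^- 2 * (qi p ^+ 2 + qj p ^+ 2 + qk p ^+ 2) = 1.
  by rewrite -nv mulVf// expf_neq0.
rewrite -exprVn in nv; move: nv; set w := `|v|^-1 => nv.
rewrite expr2; congr Quat => /=; [|ring..].
by rewrite -nv; ring.
Qed.

Lemma star_real_cst m n r (J : 'M[quat R]_(m, n)) (g : quat R -> 'M[quat R]_(n, r)) p :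
  (forall i j, J i j = (qre (J i j))%:H) -> star (fun=> J) g p = J *m g p.
Proof.
move=> Jreal; rewrite /star /lodd_part subrr !scaler0 mul0mx mul0mx addr0 subr0.
have comm (a : quat R) (M : 'M[quat R]_(n, r)) : a *: (J *m M) = J *m (a *: M).
  apply/matrixP => i j; rewrite !mxE mulr_sumr; apply: eq_bigr => k _.
  rewrite !mxE !mulrA Jreal; congr (_ * _).
  by congr Quat => /=; ring.
have half k l (M : 'M[quat R]_(k, l)) : (2^-1)%:H *: (M + M) = M.
  rewrite -[X in X + _]scale1r -[X in _ + X]scale1r -scalerDl.
  by rewrite scalerA (_ : _ * _ = 1) ?scale1r//; congr Quat => /=; field.
rewrite (_ : even_part (fun=> J) p = J); last exact: half.
rewrite comm -mulmxDr; congr (_ *m _).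
case: (im_dir_sqr p) => [[I0 pE]|I2].
  by rewrite I0 scale0r addr0 pE even_part_real.
rewrite !scalerA /even_part (_ : im_dir p * _ * _ = - (2^-1)%:H).
  rewrite scaleNr -scalerN -scalerDr opprB addrACA subrr addr0; exact: half.
have -> : im_dir p * (2^-1)%:H = (2^-1)%:H * im_dir p by congr Quat => /=; ring.
by rewrite -mulrA -expr2 I2 mulrN1.
Qed.

End RealPoints.

(* Main.v *)
From HB Require Import structures.
Require Import Defs.
From mathcomp Require Import all_boot all_order all_algebra ring lra.
From mathcomp Require Import all_classical all_reals all_analysis.

Set Implicit Arguments.
Unset Strict Implicit.
Unset Printing Implicit Defensive.
Import Order.TTheory GRing.Theory Num.Theory.
Import numFieldNormedType.Exports.

Local Open Scope classical_set_scope.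
Local Open Scope ring_scope.

(** Let [T_p = I - 2 Re(p) A + |p|^2 A^2] be the pencil whose inverse [B_p]
    appears in the characteristic function [S]. For real [x] it is the square of
    [I - x A], and the relation [A + A^* = - C J C^*] gives
    [J - S(x) J S(y)^* = (x + y) C^* (I - x A)^-1 (I - y A^* )^-1 C]. The kernel
    [K_S] is the slice hyperholomorphic extension of this factorization:
    [K_S(p, q) = T(p) T(q)^*] with [T(p) = (C^* - conj(p) C^* A) B_p]
    ([schur_kernel_formula], [schur_kernel_gram]), so that the matrices built from
    [K_S] are Gram matrices ([gram_nonneg]) and are nonnegative.

    The factorization is proved off the real axis by a direct computation rather
    than by an identity principle. A slice function is written [a + I b] with [I]
    the direction of [p] and with [a], [b] depending only on the sphere of [p]; a
    star product multiplies these pairs as if [I] were a central square root of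
    [-1]. Doing this on the left in [p] and on the right in [conj q] turns every
    factor into four components, and the half-space kernel into the expansion of
    [1 / (z + w)], [z = x + i y], [w = u + l v], with commuting [i] and [l]
    ([kker_split]). Inserting [T_p B_p = 1] or its adjoint at [q] expresses all
    products through the blocks [C^* A^i B_p B_q^* A^{*j} C], and the identity
    becomes [J - S(z) J S(w)^* = (z + w) (P00 - conj(z) P10 - conj(w) P01
    + conj(z) conj(w) P11)], compared component by component ([kernel_entry]).

    For [B_q^*] to exist, the inverse of an invertible operator must have an
    adjoint. This follows from [T^-1 = T^* (T T^* )^-1], where [T T^*] is coercive
    and so invertible by the contraction principle ([adjoint_inverse]). The same
    principle inverts [T_p] for small [p], so that [S] is defined on a half-ball.

    Slice hyperholomorphy is local: the resolvent identity gives
    the differential of [p |-> B_p w] with a quadratic remainder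
    ([resolvent_differentiable]), and the Cauchy-Riemann equation for [S] is then
    an algebraic consequence of [B_p T_p = 1] ([slice_diff_CR]). *)

(** * Quaternions *)

Section Quaternions.
Variable R : realType.
Implicit Types (p q a b : quat R) (x y : R).

Lemma quatP p q :
  qre p = qre q -> qi p = qi q -> qj p = qj q -> qk p = qk q -> p = q.
Proof. by case: p q => ????[????] /= -> -> -> ->. Qed.

Lemma qrealD x y : (x + y)%:H = x%:H + y%:H.
Proof. by apply: quatP => /=; rewrite ?addr0. Qed.

Lemma qrealN x : (- x)%:H = - x%:H.
Proof. by apply: quatP => /=; rewrite ?oppr0. Qed.

Lemma qrealM x y : (x * y)%:H = x%:H * y%:H.
Proof. by apply: quatP => /=; ring. Qed.

Lemma qreal1 : 1%:H = 1 :> quat R. Proof. by []. Qed.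

Lemma qreal0 : 0%:H = 0 :> quat R. Proof. by []. Qed.

Lemma qrealC x p : p * x%:H = x%:H * p.
Proof. by apply: quatP => /=; ring. Qed.

Lemma qscaleE x p : x *: p = x%:H * p.
Proof. by apply: quatP => /=; ring. Qed.

Lemma qconjK : involutive (@qconj R).
Proof. by move=> p; apply: quatP => /=; rewrite ?opprK. Qed.

Lemma qconjD p q : qconj (p + q) = qconj p + qconj q.
Proof. by apply: quatP => //=; rewrite opprD. Qed.

Lemma qconjN p : qconj (- p) = - qconj p.
Proof. by apply: quatP => //=; rewrite opprD. Qed.

Lemma qconjM p q : qconj (p * q) = qconj q * qconj p.
Proof. by apply: quatP => /=; ring. Qed.

Lemma qconj0 : qconj 0 = 0 :> quat R.
Proof. by apply: quatP => /=; rewrite ?oppr0. Qed.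

Lemma qconj_sum I (r : seq I) (P : pred I) (F : I -> quat R) :
  qconj (\sum_(i <- r | P i) F i) = \sum_(i <- r | P i) qconj (F i).
Proof. by apply: (big_morph _ qconjD qconj0). Qed.

Lemma qnormE p : `|p| = Num.sqrt (qinner p p). Proof. by []. Qed.

Lemma qnorm2 p : `|p| ^+ 2 = qinner p p.
Proof. by rewrite qnormE sqr_sqrtr ?qinner_ge0. Qed.

Lemma qnormM p q : `|p * q| = `|p| * `|q|.
Proof.
rewrite !qnormE -sqrtrM ?qinner_ge0//; congr Num.sqrt.
by rewrite /qinner /=; ring.
Qed.

Lemma qnorm_conj p : `|qconj p| = `|p|.
Proof. by rewrite !qnormE; congr Num.sqrt; rewrite /qinner /=; ring. Qed.

Lemma qnorm_real x : `|x%:H| = `|x|.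
Proof.
by rewrite qnormE /qinner /= -sqrtr_sqr; congr Num.sqrt; ring.
Qed.

Lemma qmulqc p : p * qconj p = (`|p| ^+ 2)%:H.
Proof. by rewrite qnorm2; apply: quatP; rewrite /qinner /=; ring. Qed.

Lemma qre_norm p : `|qre p| <= `|p|.
Proof.
rewrite -sqrtr_sqr qnormE ler_sqrt ?qinner_ge0// /qinner.
by have := (sqr_ge0 (qi p), sqr_ge0 (qj p), sqr_ge0 (qk p)) => -[[]]; nra.
Qed.

Lemma qinner_norm p q : `|qinner p q| <= `|p| * `|q|.
Proof.
have -> : qinner p q = qre (qconj p * q) by rewrite /qinner /=; ring.
by rewrite (le_trans (qre_norm _))// qnormM qnorm_conj.
Qed.

Lemma im_sphere_sqr (I : quat R) : im_sphere I -> I * I = -1.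
Proof.
case=> I0 I1; have := qnorm2 I; rewrite I1 expr1n /qinner I0 => h.
by apply: quatP => /=; rewrite ?I0; [rewrite h; ring|ring..].
Qed.

(** The coordinate [y >= 0] of [p = x + I y] with [I = im_dir p]. For real [p]
    both [I] and [y] vanish, so that the rule [I I = -1] only holds in the form
    [I I y = - y]. *)
Definition im_abs p : R := `|p - (qre p)%:H|.

Lemma polar p : p = (qre p)%:H + im_dir p * (im_abs p)%:H.
Proof.
rewrite /im_dir /im_abs /=; set v := p - _.
have [v0|v0] := eqVneq v 0.
  by rewrite v0 scaler0 mul0r addr0; apply/eqP; rewrite -subr_eq0 -/v v0.
rewrite qscaleE -mulrA qrealC mulrA -qrealM mulVf ?normr_eq0// qreal1 mul1r.
by rewrite /v addrC subrK.
Qed.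

Lemma im_dir_conj p : im_dir (qconj p) = - im_dir p.
Proof.
rewrite /im_dir /=; have -> : qconj p - (qre p)%:H = - (p - (qre p)%:H).
  by apply: quatP => /=; ring.
by rewrite normrN scalerN.
Qed.

Lemma im_abs_conj p : im_abs (qconj p) = im_abs p.
Proof.
rewrite /im_abs /=; have -> : qconj p - (qre p)%:H = - (p - (qre p)%:H).
  by apply: quatP => /=; ring.
by rewrite normrN.
Qed.

Lemma im_dir_abs p : im_dir p * im_dir p * (im_abs p)%:H = - (im_abs p)%:H.
Proof.
case: (im_dir_sqr p) => [[I0 pE]|]; last by rewrite expr2 => ->; rewrite mulN1r.
by rewrite I0 /im_abs -pE subrr normr0 mulr0 qreal0 oppr0.
Qed.

Lemma qnorm2_polar p : `|p| ^+ 2 = qre p ^+ 2 + im_abs p ^+ 2.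
Proof.
by rewrite /im_abs !qnorm2 /qinner /=; ring.
Qed.

End Quaternions.

(** * Right quaternionic Hilbert spaces and their operators *)

Section InnerProduct.
Variables (R : realType) (V : rqInnerType R).
Implicit Types (u v w : V) (a b : quat R) (x : R).

Lemma rscaleZ x v a : x *: (v :* a) = (x *: v) :* a.
Proof. by rewrite -!rscale_real !rscaleA qrealC. Qed.

Lemma qdotDr u v w : qdot u (v + w) = qdot u v + qdot u w.
Proof. by rewrite qdotC qdotDl qconjD -!qdotC. Qed.

Lemma qdotZr u v a : qdot u (v :* a) = qconj a * qdot u v.
Proof. by rewrite qdotC qdotZl qconjM -qdotC. Qed.

Lemma qdotxl x u v : qdot (x *: u) v = x%:H * qdot u v.
Proof. by rewrite -rscale_real qdotZl qrealC. Qed.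

Lemma qdotxr x u v : qdot u (x *: v) = x%:H * qdot u v.
Proof. by rewrite -rscale_real qdotZr qconj_real. Qed.

Lemma qdot0l v : qdot 0 v = 0.
Proof. by rewrite -(scale0r (0 : V)) qdotxl qreal0 mul0r. Qed.

Lemma qdot0r v : qdot v 0 = 0.
Proof. by rewrite qdotC qdot0l qconj0. Qed.

Lemma qdotNl u v : qdot (- u) v = - qdot u v.
Proof. by rewrite -scaleN1r qdotxl qrealN mulN1r. Qed.

Lemma qdotNr u v : qdot u (- v) = - qdot u v.
Proof. by rewrite -scaleN1r qdotxr qrealN mulN1r. Qed.

Lemma qdot_suml I (r : seq I) (P : pred I) (F : I -> V) v :
  qdot (\sum_(i <- r | P i) F i) v = \sum_(i <- r | P i) qdot (F i) v.
Proof. by apply: (big_morph (qdot^~ v)) => [a b|]; rewrite ?qdotDl ?qdot0l. Qed.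

Lemma qdot_sumr I (r : seq I) (P : pred I) (F : I -> V) v :
  qdot v (\sum_(i <- r | P i) F i) = \sum_(i <- r | P i) qdot v (F i).
Proof. by apply: (big_morph _ (qdotDr v) (qdot0r v)). Qed.

Lemma qdot_ext v w : (forall u, qdot u v = qdot u w) -> v = w.
Proof.
move=> vw; apply/eqP; rewrite -subr_eq0 -normr_eq0 -sqrf_eq0 -qdot_norm.
by rewrite qdotDr qdotNr vw subrr.
Qed.

Lemma re_qdotC u v : qre (qdot u v) = qre (qdot v u).
Proof. by rewrite qdotC. Qed.

Lemma qnorm_addZ x u v :
  `|u + x *: v| ^+ 2 = `|u| ^+ 2 + 2 * x * qre (qdot u v) + x ^+ 2 * `|v| ^+ 2.
Proof.
rewrite -!qdot_norm qdotDl !qdotDr !qdotxl !qdotxr /= (re_qdotC v u); ring.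
Qed.

Lemma re_qdot_le u v : qre (qdot u v) <= `|u| * `|v|.
Proof.
have [->|u0] := eqVneq u 0; first by rewrite qdot0l normr0 mul0r.
have [->|v0] := eqVneq v 0; first by rewrite qdot0r normr0 mulr0.
have := sqr_ge0 `| `|v| *: u + (- `|u|) *: v|.
rewrite qnorm_addZ normrZ normr_id qdotxl /=.
have : 0 < `|u| by rewrite normr_gt0.
have : 0 < `|v| by rewrite normr_gt0.
set a := `|u|; set b := `|v|; set t := qre _ => b0 a0 h.
suff : 0 <= 2 * (a * b) * (a * b - t) by rewrite pmulr_rge0 ?subr_ge0// !mulr_gt0.
by apply: le_trans h _; rewrite le_eqVlt; apply/orP; left; apply/eqP; ring.
Qed.

(** Pairing with an arbitrary vector turns a linear identity between vectors into
    an identity between real numbers, which [ring] decides. *)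
Definition redot v u : R := qre (qdot v u).

Lemma redot_ext v w : (forall u, redot v u = redot w u) -> v = w.
Proof.
move=> vw; apply/eqP; rewrite -subr_eq0 -normr_eq0 -sqrf_eq0 -qdot_norm.
by rewrite qdotDl qdotNl /=; have := vw (v - w); rewrite /redot => ->; rewrite subrr.
Qed.

Lemma redotD v w u : redot (v + w) u = redot v u + redot w u.
Proof. by rewrite /redot qdotDl. Qed.

Lemma redotN v u : redot (- v) u = - redot v u.
Proof. by rewrite /redot qdotNl. Qed.

Lemma redotZ x v u : redot (x *: v) u = x * redot v u.
Proof. by rewrite /redot qdotxl /=; ring. Qed.

Definition redotE := (redotD, redotN, redotZ).

End InnerProduct.

Section RightLinear.
Variable R : realType.
Implicit Types U V W : rqInnerType R.

Lemma rlin_add U V (T : U -> V) (rT : right_linear T) u v :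
  T (u + v) = T u + T v.
Proof. exact: rT.1. Qed.

Lemma rlin_rscale U V (T : U -> V) (rT : right_linear T) u a :
  T (u :* a) = T u :* a.
Proof. exact: rT.2. Qed.

Lemma rlin_scale U V (T : U -> V) (rT : right_linear T) x u :
  T (x *: u) = x *: T u.
Proof. by rewrite -!rscale_real (rlin_rscale rT). Qed.

Lemma rlin0 U V (T : U -> V) : right_linear T -> T 0 = 0.
Proof. by move=> rT; rewrite -(scale0r (0 : U)) (rlin_scale rT) scale0r. Qed.

Lemma rlin_opp U V (T : U -> V) (rT : right_linear T) u : T (- u) = - T u.
Proof. by rewrite -scaleN1r (rlin_scale rT) scaleN1r. Qed.

Lemma rlin_sub U V (T : U -> V) (rT : right_linear T) u v :
  T (u - v) = T u - T v.
Proof. by rewrite (rlin_add rT) (rlin_opp rT). Qed.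

Lemma rlin_sum U V (T : U -> V) (rT : right_linear T) I (r : seq I) (P : pred I)
    (F : I -> U) :
  T (\sum_(i <- r | P i) F i) = \sum_(i <- r | P i) T (F i).
Proof.
by apply: (big_morph T) => [a b|]; rewrite ?(rlin0 rT) ?(rlin_add rT).
Qed.

Lemma rlin_id U : right_linear (@id U). Proof. by []. Qed.

Lemma rlin_comp U V W (S : V -> W) (T : U -> V) :
  right_linear S -> right_linear T -> right_linear (S \o T).
Proof.
move=> rS rT; split=> [u v|u a] /=.
  by rewrite (rlin_add rT) (rlin_add rS).
by rewrite (rlin_rscale rT) (rlin_rscale rS).
Qed.

Lemma rlin_iter U (T : U -> U) i : right_linear T -> right_linear (iter i T).
Proof. by move=> rT; elim: i => [|i IH]; [exact: rlin_id|exact: rlin_comp]. Qed.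

Lemma rlin_plus U V (S T : U -> V) :
  right_linear S -> right_linear T -> right_linear (fun u => S u + T u).
Proof.
move=> rS rT; split=> [u v|u a] /=.
  by rewrite (rlin_add rS) (rlin_add rT) addrACA.
by rewrite (rlin_rscale rS) (rlin_rscale rT) rscaleDl.
Qed.

Lemma rlin_scaled U V x (T : U -> V) :
  right_linear T -> right_linear (fun u => x *: T u).
Proof.
move=> rT; split=> [u v|u a] /=; first by rewrite (rlin_add rT) scalerDr.
by rewrite (rlin_rscale rT) rscaleZ.
Qed.

Lemma bop_pos U V (T : U -> V) : bounded_operator T ->
  exists2 M : R, 0 < M & forall u, `|T u| <= M * `|u|.
Proof.
case=> _ [M TM]; exists (`|M| + 1); first by rewrite ltr_wpDl.
move=> u; apply: le_trans (TM u) _; rewrite ler_wpM2r//.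
by rewrite (le_trans (ler_norm M))// lerDl.
Qed.

Lemma bop_comp U V W (S : V -> W) (T : U -> V) :
  bounded_operator S -> bounded_operator T -> bounded_operator (S \o T).
Proof.
move=> bS bT; split; first by apply: rlin_comp; [case: bS|case: bT].
have [M M0 SM] := bop_pos bS; have [N N0 TN] := bop_pos bT.
exists (M * N) => u /=; apply: le_trans (SM _) _.
by rewrite -mulrA ler_pM2l.
Qed.

Lemma bop_plus U V (S T : U -> V) :
  bounded_operator S -> bounded_operator T -> bounded_operator (fun u => S u + T u).
Proof.
move=> [rS [M SM]] [rT [N TN]]; split; first exact: rlin_plus.
by exists (M + N) => u; rewrite (le_trans (ler_normD _ _))// mulrDl lerD.
Qed.

Lemma bop_scaled U V x (T : U -> V) :
  bounded_operator T -> bounded_operator (fun u => x *: T u).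
Proof.
move=> [rT [M TM]]; split; first exact: rlin_scaled.
by exists (`|x| * M) => u; rewrite normrZ -mulrA ler_wpM2l.
Qed.

Lemma bop_id U : bounded_operator (@id U).
Proof. by split=> //; exists 1 => u; rewrite mul1r. Qed.

Lemma adjoint_sym U V (T : U -> V) Ts : adjoint_of T Ts -> adjoint_of Ts T.
Proof. by move=> aT u v; rewrite qdotC -aT -qdotC. Qed.

Lemma adjoint_comp U V W (S : V -> W) Ss (T : U -> V) Ts :
  adjoint_of S Ss -> adjoint_of T Ts -> adjoint_of (S \o T) (Ts \o Ss).
Proof. by move=> aS aT u v; rewrite /= aS aT. Qed.

Lemma adjoint_rlin U V (T : U -> V) Ts : adjoint_of T Ts -> right_linear Ts.
Proof.
move=> aT; split=> [u v|u a]; apply: qdot_ext => w.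
  by rewrite qdotDr -!aT qdotDr.
by rewrite qdotZr -!aT qdotZr.
Qed.

Lemma adjoint_bop U V (T : U -> V) Ts :
  bounded_operator T -> adjoint_of T Ts -> bounded_operator Ts.
Proof.
move=> bT aT; split; first exact: adjoint_rlin aT.
have [M M0 TM] := bop_pos bT; exists M => v.
have [->|v0] := eqVneq (Ts v) 0; first by rewrite normr0 mulr_ge0// ltW.
have n0 : 0 < `|Ts v| by rewrite normr_gt0.
rewrite -(ler_pM2l n0) -expr2 -qdot_norm -aT (le_trans (re_qdot_le _ _))//.
by rewrite mulrCA mulrA ler_wpM2r.
Qed.

Lemma boundedly_invertible_below U (T : U -> U) (c : R) : right_linear T ->
  0 < c -> (forall v, c * `|v| <= `|T v|) -> (forall w, exists v, T v = w) ->
  boundedly_invertible T.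
Proof.
move=> rT c0 below onto; pose B w := xget 0 [set v | T v = w].
have TB w : T (B w) = w by rewrite /B; case: xgetP => //= h; case: (onto w) => v /h.
have inj u v : T u = T v -> u = v.
  move=> uv; apply/eqP; rewrite -subr_eq0 -normr_eq0; apply/eqP.
  have := below (u - v); rewrite (rlin_sub rT) uv subrr normr0 pmulr_rle0// => h.
  by apply/eqP; rewrite eq_le h normr_ge0.
exists B; split=> // [|v]; last exact: inj.
split; first by split=> *; apply: inj; rewrite !(TB, rlin_add rT, rlin_rscale rT).
by exists c^-1 => u; rewrite -(ler_pM2l c0) mulrA divff ?gt_eqF// mul1r -{2}(TB u).
Qed.

End RightLinear.

Section Invertibility.
Variables (R : realType) (V : rqHilbertType R).
Implicit Types (T : V -> V).

(** Solving [T v = w] is finding a fixed point of the contraction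
    [v |-> v - T v + w]. *)
Lemma invertible_near_id T (k : R) : right_linear T -> k < 1 ->
  (forall v, `|v - T v| <= k * `|v|) -> boundedly_invertible T.
Proof.
move=> rT k1 Tk; apply: (@boundedly_invertible_below _ _ _ (1 - k)) => //.
- by rewrite subr_gt0.
- move=> v; rewrite mulrBl mul1r lerBlDr; apply: le_trans (lerD (lexx _) (Tk v)).
  by rewrite (le_trans _ (ler_normD _ _))// addrC subrK.
move=> w; have k0 : 0 <= Num.max k 0 by rewrite le_max lexx orbT.
pose f (v : V) : V := v - T v + w.
have fS : set_fun [set: V] [set: V] f by [].
pose F : {fun [set: V] >-> [set: V]} := HB.pack f (isFun.Build _ _ _ _ f fS).
have ctr : is_contraction F.
  exists (NngNum k0); split; first by rewrite /= gt_max k1 ltr01.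
  move=> [u v] _ /=; have -> : f u - f v = u - v - T (u - v).
    rewrite /f (rlin_sub rT) opprD addrACA subrr addr0 !opprB.
    by rewrite addrACA [RHS]addrACA; congr (_ + _); rewrite addrC.
  by rewrite (le_trans (Tk _))// ler_wpM2r// le_max lexx.
have [|v _ vE] := banach_fixed_point ctr closedT; first by exists 0.
exists v; apply/eqP; rewrite eq_sym -subr_eq0; apply/eqP.
by apply: (addrI v); rewrite addr0 [in RHS]vE /= /f -addrA [- _ + _]addrC.
Qed.

(** For a coercive [T], the operator [t T] is close to the identity as soon as
    [t] is small. *)
Lemma invertible_coercive T (c : R) : bounded_operator T -> 0 < c ->
  (forall v, c * `|v| ^+ 2 <= qre (qdot (T v) v)) -> boundedly_invertible T.
Proof.
move=> bT c0 coer; have [M M0 TM] := bop_pos bT; have rT := bT.1.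
pose N := M + c; have N0 : 0 < N by rewrite addr_gt0.
have [cge0 Nge0] := (ltW c0, ltW N0).
(* the value of t that minimizes the bound 1 - 2 t c + t^2 N^2 *)
pose t := c / N ^+ 2; have t0 : 0 < t by rewrite divr_gt0// exprn_gt0.
pose k := Num.sqrt (1 - c ^+ 2 / N ^+ 2).
have k1 : k < 1.
  by rewrite -sqrtr1 ltr_sqrt// ltrBlDl ltrDr divr_gt0// exprn_gt0.
have cN : c ^+ 2 / N ^+ 2 <= 1.
  rewrite ler_pdivrMr ?exprn_gt0// mul1r ler_pXn2r ?nnegrE//.
  by rewrite /N lerDr ltW.
have rtT : right_linear (fun v => t *: T v) by exact: rlin_scaled.
have [|B [bB BK KB]] := invertible_near_id rtT k1.
  move=> v; rewrite -(@ler_pXn2r _ 2)// ?nnegrE ?mulr_ge0 ?sqrtr_ge0//.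
  rewrite exprMn sqr_sqrtr ?subr_ge0// -scaleNr qnorm_addZ re_qdotC.
  have h1 := coer v.
  have h2 : `|T v| ^+ 2 <= N ^+ 2 * `|v| ^+ 2.
    rewrite -exprMn ler_pXn2r ?nnegrE ?mulr_ge0//.
    by rewrite (le_trans (TM v))// ler_wpM2r// lerDl ltW.
  have h3 : t * (c * `|v| ^+ 2) <= t * qre (qdot (T v) v) by rewrite ler_pM2l.
  have h4 : t ^+ 2 * `|T v| ^+ 2 <= t ^+ 2 * (N ^+ 2 * `|v| ^+ 2).
    by rewrite ler_pM2l// exprn_gt0.
  have h5 : t ^+ 2 * (N ^+ 2 * `|v| ^+ 2) = c ^+ 2 / N ^+ 2 * `|v| ^+ 2.
    by rewrite /t; field; rewrite gt_eqF.
  have h6 : t * (c * `|v| ^+ 2) = c ^+ 2 / N ^+ 2 * `|v| ^+ 2.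
    by rewrite /t; field; rewrite gt_eqF.
  rewrite h5 in h4; rewrite h6 in h3; move: h3 h4; rewrite mulrBl mul1r.
  rewrite sqrrN mulrN mulNr -(mulrA 2).
  lra.
exists (fun v => t *: B v); split.
- exact: bop_scaled.
- by move=> v; have := BK v; rewrite -(rlin_scale bB.1).
- by move=> v; have := KB v; rewrite -[in X in X -> _](rlin_scale rT).
Qed.

(** An invertible [T] is bounded below with its adjoint, so [T T^*] is coercive,
    hence invertible; then [T^-1 = T^* (T T^* )^-1], and the right-hand side has
    the adjoint [(T T^* )^-1 T]. *)
Lemma adjoint_inverse (T Ts B : V -> V) : bounded_operator T -> adjoint_of T Ts ->
    bounded_operator B -> cancel B T -> cancel T B ->
  exists Bs, adjoint_of B Bs.
Proof.
move=> bT aT bB BK KB; have [b b0 Bb] := bop_pos bB; have bge0 := ltW b0.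
have aTs := adjoint_sym aT; have bTs := adjoint_bop bT aT.
have [|||D [bD TTD DTT]] := @invertible_coercive (T \o Ts) (b ^- 2).
- exact: bop_comp.
- by rewrite invr_gt0 exprn_gt0.
- move=> v /=; rewrite aT qdot_norm.
  rewrite -exprVn -exprMn ler_pXn2r ?nnegrE ?mulr_ge0 ?invr_ge0//.
  rewrite ler_pdivrMl//; have [->|v0] := eqVneq v 0.
    by rewrite normr0 mulr_ge0.
  have n0 : 0 < `|v| by rewrite normr_gt0.
  rewrite -(ler_pM2l n0) -expr2 -qdot_norm -{1}(BK v) aT.
  by rewrite (le_trans (re_qdot_le _ _))// [leRHS]mulrA ler_wpM2r// mulrC.
exists (D \o T) => u v /=.
have /= uE := DTT u; have -> : B u = Ts (D u) by rewrite -[in LHS]uE KB.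
by have /= vE := DTT (T v); rewrite aTs -[in LHS]vE -aTs -aT uE.
Qed.

End Invertibility.

(** * The half-ball and the pencil near the origin *)

Section Convexity.
Variable R : realType.

(** The segments from a fixed point of [D] are connected, and cover [D]. *)
Lemma segment_convex_connected (V : normedModType R) (D : set V) :
  (forall x y (t : R), D x -> D y -> 0 <= t <= 1 -> D (x + t *: (y - x))) ->
  connected D.
Proof.
move=> cD; have [->|/set0P[x Dx]] := eqVneq D set0; first exact: connected0.
pose seg y := (fun t : R => x + t *: (y - x)) @` `[0, 1].
have -> : D = \bigcup_(y in D) seg y.
  apply/seteqP; split=> [y Dy|y [z Dz [t /=]]].
    exists y => //; exists 1; first by rewrite /= in_itv /= ler01 lexx.
    by rewrite scale1r addrC subrK.
  by rewrite in_itv /= => t01 <-; exact: cD.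
apply: bigcup_connected => [|y Dy].
  exists x => y Dy; exists 0; first by rewrite /= in_itv /= ler01 lexx.
  by rewrite scale0r addr0.
apply: connected_continuous_connected; first exact: segment_connected.
apply: continuous_subspaceT => t.
apply: cvgD; first exact: cvg_cst.
by apply: cvgZr_tmp; exact: cvg_id.
Qed.

End Convexity.

Section HalfBall.
Variable R : realType.

Lemma qre_continuous : continuous (@qre R).
Proof.
move=> p; apply/(@cvgrPdist_lt _ _ _ (nbhs p)) => e e0.
apply/nbhs_normP; exists e => //= q pq.
by rewrite -[_ - _]/(qre (p - q)) (le_lt_trans (qre_norm _)).
Qed.

Lemma spt_continuous (I : quat R) : continuous (fun z : R * R => spt I z.1 z.2).
Proof.
have realE (x : R) : x%:H = x *: (1 : quat R) by rewrite qscaleE mulr1.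
have sptE (x y : R) : spt I x y = x *: (1 : quat R) + y *: I.
  by rewrite /spt qrealC -qscaleE realE.
move=> z.
rewrite (_ : (fun _ => _) = (fun z : R * R => z.1 *: (1 : quat R) + z.2 *: I));
  last first.
  by apply/funext => -[x y]; rewrite sptE.
apply: cvgD; apply: cvgZr_tmp; [exact: cvg_fst|exact: cvg_snd].
Qed.

Lemma spt_re (I : quat R) x y : im_sphere I -> qre (spt I x y) = x.
Proof. by case=> I0 _; rewrite /spt /= I0; ring. Qed.

Lemma spt_norm (I : quat R) x y : im_sphere I -> `|spt I x y| ^+ 2 = x ^+ 2 + y ^+ 2.
Proof.
case=> I0 I1; have := qnorm2 I; rewrite I1 expr1n qnorm2 /qinner /spt /= I0 => h.
rewrite -[y ^+ 2]mul1r h; ring.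
Qed.

(** Convexity makes both this set and its slices connected. *)
Definition half_ball (e : R) : set (quat R) := [set p | 0 < qre p /\ `|p| < e].

Lemma half_ball_open e : open (half_ball e).
Proof.
rewrite (_ : half_ball e = (@qre R @^-1` [set x | 0 < x]) `&`
   (Num.norm @^-1` [set x : R | x < e]))//.
apply: openI; apply: open_comp.
- by move=> p _; exact: qre_continuous.
- exact: open_gt.
- by move=> p _; exact: norm_continuous.
- exact: open_lt.
Qed.

Lemma half_ball_convex e (p q : quat R) (t : R) : half_ball e p -> half_ball e q ->
  0 <= t <= 1 -> half_ball e (p + t *: (q - p)).
Proof.
move=> [p0 pe] [q0 qe] /andP[t0 t1].
have -> : p + t *: (q - p) = (1 - t) *: p + t *: q.
  by rewrite scalerBr scalerBl scale1r addrA addrAC.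
have s0 : 0 <= 1 - t by rewrite subr_ge0.
have conv_pos (x y : R) : 0 < x -> 0 < y -> 0 < (1 - t) * x + t * y.
  move=> x0 y0; have [->|tn0] := eqVneq t 0; first by rewrite subr0 mul1r mul0r addr0.
  by rewrite ltr_wpDl ?mulr_ge0 ?(ltW x0)// mulr_gt0// lt_def tn0.
split; first exact: conv_pos.
rewrite (le_lt_trans (ler_normD _ _))// !normrZ !ger0_norm// -subr_gt0.
have -> : e - ((1 - t) * `|p| + t * `|q|) = (1 - t) * (e - `|p|) + t * (e - `|q|).
  by ring.
by rewrite conv_pos ?subr_gt0.
Qed.

Lemma half_ball_s_domain e : 0 < e -> half_space_s_domain (half_ball e).
Proof.
move=> e0; have e2 : 0 < e / 2 by rewrite divr_gt0.
have hx : half_ball e (e / 2)%:H.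
  by split=> //; rewrite qnorm_real gtr0_norm//; lra.
split.
- split; last move=> I I1; last 1 first.
  + split.
    * have /continuousP := @spt_continuous I; apply; exact: half_ball_open.
    * apply: segment_convex_connected => -[x y] [x' y'] t /= h h' t01.
      change (half_ball e (spt I (x + t * (x' - x)) (y + t * (y' - y)))).
      rewrite (_ : spt _ _ _ = spt I x y + t *: (spt I x' y' - spt I x y)).
        exact: half_ball_convex.
      by rewrite /spt !qscaleE; apply: quatP => /=; ring.
    * exists (e / 2, 0) => /=; rewrite /spt /= mulr0 addr0; exact: hx.
  + split; [exact: half_ball_open| |by exists (e / 2)%:H].
    apply: segment_convex_connected; exact: half_ball_convex.
  + by exists (e / 2).
- move=> I x y I1 [h1 h2] I' I1'; split; first by rewrite spt_re// -(spt_re x y I1).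
  have ege := ltW e0; rewrite -(ltr_pXn2r (n := 2)) ?nnegrE// spt_norm//.
  by rewrite -(spt_norm x y I1) ltr_pXn2r ?nnegrE.
- by move=> p [].
- by exists (e / 2).
Qed.

End HalfBall.

Section Pencil.
Variables (R : realType) (V : rqInnerType R) (A As : V -> V).
Hypothesis A_bounded : bounded_operator A.
Implicit Types p : quat R.

Lemma spencil_bounded p : bounded_operator (spencil A p).
Proof.
have -> : spencil A p = (fun v => (id v + - (2 * qre p) *: A v)
    + `|p| ^+ 2 *: (A \o A) v) by apply/funext => v; rewrite scaleNr.
apply: bop_plus; last by apply: bop_scaled; exact: bop_comp.
by apply: bop_plus; [exact: bop_id|exact: bop_scaled].
Qed.

Lemma spencil_conj p : spencil A (qconj p) = spencil A p.
Proof. by rewrite /spencil qnorm_conj. Qed.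

Lemma spencil_adjoint p : adjoint_of A As -> adjoint_of (spencil A p) (spencil As p).
Proof.
move=> aA u v; rewrite /spencil !(qdotDl, qdotDr, qdotNl, qdotNr, qdotxl, qdotxr).
by rewrite !aA.
Qed.

Lemma spencil_comm p v : A (spencil A p v) = spencil A p (A v).
Proof.
have rA := A_bounded.1; rewrite /spencil.
by rewrite (rlin_add rA) (rlin_sub rA) !(rlin_scale rA).
Qed.

End Pencil.

Lemma spencil_invertible_near0 (R : realType) (V : rqHilbertType R) (A : V -> V) :
  bounded_operator A ->
  exists2 e : R, 0 < e & forall p, `|p| < e -> boundedly_invertible (spencil A p).
Proof.
move=> bA; have [M M0 AM] := bop_pos bA; exists (4 * M)^-1.
  by rewrite invr_gt0 mulr_gt0.
move=> p pe; have rT := (spencil_bounded bA p).1.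
have pM : `|p| * M < 4^-1.
  by rewrite -ltr_pdivlMr// -invfM.
apply: (@invertible_near_id _ _ _ (3 / 4)) => // [|v]; first by lra.
rewrite /spencil opprD addrA opprB [v + _]addrC subrK.
rewrite (le_trans (ler_normB _ _))//.
rewrite (normrZ (2 * qre p)) (normrZ (`|p| ^+ 2)).
have v0 := normr_ge0 v; have p0 := normr_ge0 p.
have h1 : `|2 * qre p| * `|A v| <= 2 * (`|p| * M) * `|v|.
  rewrite normrM (@ger0_norm _ 2)// -!mulrA ler_pM2l//.
  by rewrite ler_pM// qre_norm.
have h2 : `| `|p| ^+ 2 | * `|A (A v)| <= (`|p| * M) ^+ 2 * `|v|.
  rewrite ger0_norm ?sqr_ge0// exprMn -[leRHS]mulrA ler_wpM2l ?sqr_ge0//.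
  by rewrite (le_trans (AM _))// expr2 -[leRHS]mulrA ler_pM2l.
have q0 : 0 <= `|p| * M by rewrite mulr_ge0// ltW.
rewrite (le_trans (lerD h1 h2))// -mulrDl ler_wpM2r//.
by move: pM q0; set a := _ * M; nra.
Qed.

(** * Differentiability from a quadratic remainder *)

Section SecondOrder.
Variables (R : realType) (V W : normedModType R).

(** Such a bound exhibits the differential, which reduces the Cauchy-Riemann
    equation to algebra. *)
Definition quadratic_remainder (f : V -> W) (x : V) (L : V -> W) :=
  exists M d : R, 0 < d /\
    forall h, `|h| < d -> `|f (x + h) - f x - L h| <= M * `|h| ^+ 2.

Lemma quadratic_remainder_diff (f : V -> W) (x : V) (L : V -> W) (K : R) :
  linear L -> (forall h, `|L h| <= K * `|h|) -> quadratic_remainder f x L ->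
  differentiable f x /\ 'd f x = L :> (V -> W).
Proof.
move=> linL LK [M [d [d0 rem]]].
pose Ll : {linear V -> W} := HB.pack L (GRing.isLinear.Build R V W _ L linL).
have Lc : continuous Ll.
  apply/linear_bounded_continuous/linear_boundedP; exists K.
  split; first exact: num_real.
  by move=> r Kr h; rewrite (le_trans (LK h))// ler_wpM2r// ltW.
have fo : f \o shift x = cst (f x) + Ll +o_ (0 : V) id.
  apply/eqaddoP => e e0; near=> h.
  rewrite (_ : (_ - _) h = f (x + h) - f x - L h); last first.
    by rewrite /= !fctE /= opprD addrA [h + x]addrC.
  have hd : `|h| < d by near: h; apply/nbhs_norm0P; exists d.
  rewrite (le_trans (rem h hd))//.
  rewrite expr2 mulrA ler_wpM2r//.
  apply: (@le_trans _ _ ((`|M| + 1) * `|h|)).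
    by rewrite ler_wpM2r// (le_trans (ler_norm M))// lerDl.
  rewrite -ler_pdivlMl ?ltr_wpDl//; apply: ltW; near: h.
  apply/nbhs_norm0P; exists ((`|M| + 1)^-1 * e) => //=.
  by rewrite mulr_gt0// invr_gt0 ltr_wpDl.
have dL := diff_unique Lc fo; split; last exact: dL.
apply/diff_locallyP; split; first by rewrite dL.
by rewrite dL.
Unshelve. all: by end_near. Qed.

Lemma derive1_along_line (f : V -> W) (c : R -> V) (t : R) (e : V) :
  (forall h, c (h + t) = h *: e + c t) -> differentiable f (c t) ->
  derive1 (fun s => f (c s)) t = 'd f (c t) e.
Proof.
move=> ce df; rewrite -deriveE// /derive1 /derive.
have -> : (fun h => h^-1 *: (f (c (h + t)) - f (c t))) =
    (fun h => h^-1 *: ((f \o shift (c t)) (h *: e) - f (c t))).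
  by apply/funext => h /=; rewrite ce.
by [].
Qed.

End SecondOrder.

(** * Differentiability of the resolvent *)

Section Resolvent.
Variables (R : realType) (V : rqInnerType R).

Lemma op_invE (T B : V -> V) : cancel T B -> cancel B T -> op_inv T = B.
Proof.
move=> TB BT; apply/funext => w; rewrite /op_inv; case: xgetP => [v _ /= <-|].
  by rewrite TB.
by move=> /(_ (B w)) /=; rewrite BT.
Qed.

Lemma op_inv_spec (T : V -> V) : boundedly_invertible T ->
  [/\ bounded_operator (op_inv T), cancel T (op_inv T) & cancel (op_inv T) T].
Proof. by case=> B [bB TB BT]; rewrite (op_invE TB BT). Qed.

Variables (A : V -> V) (w : V).
Hypothesis A_bounded : bounded_operator A.

Let u p := op_inv (spencil A p) w.

(** The derivative of the resolvent at [p], from the second resolvent identity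
    [B_(p+h) - B_p = - B_p (T_(p+h) - T_p) B_(p+h)] for the pencils
    [T_p = B_p^-1]. *)
Definition dresolvent p h : V :=
  op_inv (spencil A p) ((2 * qre h) *: A (u p) - (2 * qinner p h) *: A (A (u p))).

Let incr (p h : quat R) v : V :=
  (2 * qinner p h + `|h| ^+ 2) *: A (A v) - (2 * qre h) *: A v.

Lemma qnorm2D (p h : quat R) :
  `|p + h| ^+ 2 = `|p| ^+ 2 + (2 * qinner p h + `|h| ^+ 2).
Proof. by rewrite !qnorm2 /qinner /=; ring. Qed.

Let spencilD p h v : spencil A (p + h) v = spencil A p v + incr p h v.
Proof.
by apply: redot_ext => z; rewrite /spencil /incr qnorm2D !redotE /=; ring.
Qed.

(** The resolvent identity gives [u (p + h) - u p = - B_p E_h (u (p + h))], where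
    the increment [E_h] of the pencil is [O(h)]. For small [h] this bounds
    [u (p + h)] by twice [u p], hence the difference is [O(h)]; inserting that
    bound in the identity again leaves a remainder [O(h^2)]. *)
Lemma resolvent_differentiable (p : quat R) (e : R) : 0 < e ->
  (forall h, `|h| < e -> boundedly_invertible (spencil A (p + h))) ->
  exists M d : R, [/\ 0 < M, 0 < d, d <= 1 & forall h, `|h| < d ->
    `|u (p + h) - u p| <= M * `|h| /\
    `|u (p + h) - u p - dresolvent p h| <= M * `|h| ^+ 2].
Proof.
move=> e0 inv; have [a a0 Aa] := bop_pos A_bounded; have rA := A_bounded.1.
have [|bB BK KB] := @op_inv_spec (spencil A p).
  by rewrite -[p]addr0; apply: inv; rewrite normr0.
have [b b0 Bb] := bop_pos bB; have rB := bB.1.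
pose B := op_inv (spencil A p); rewrite -/B in bB BK KB Bb rB.
have AAa v : `|A (A v)| <= a ^+ 2 * `|v|.
  by rewrite (le_trans (Aa _))// expr2 -[leRHS]mulrA ler_pM2l.
pose c := 2 * a + (2 * `|p| + 1) * a ^+ 2.
have p0 := normr_ge0 p.
have c0 : 0 < c by rewrite /c addr_gt0// ?mulr_gt0 ?exprn_gt0//; lra.
have incr_le h v : `|h| <= 1 -> `|incr p h v| <= c * `|h| * `|v|.
  move=> h1; have h0 := normr_ge0 h; have v0 := normr_ge0 v.
  rewrite /incr (le_trans (ler_normB _ _))//.
  rewrite (normrZ (2 * qre h)) (normrZ (2 * qinner p h + `|h| ^+ 2)).
  have h2 : `|2 * qre h| * `|A v| <= 2 * `|h| * (a * `|v|).
    by rewrite normrM (@ger0_norm _ 2)// ler_pM// ?mulr_ge0// ler_pM2l// qre_norm.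
  have h3 : `|2 * qinner p h + `|h| ^+ 2| * `|A (A v)|
      <= (2 * `|p| + 1) * `|h| * (a ^+ 2 * `|v|).
    apply: ler_pM => //; apply: (le_trans (ler_normD _ _)).
    rewrite (mulrDl (2 * `|p|) 1).
    apply: lerD.
      by rewrite normrM (@ger0_norm _ 2)// -mulrA ler_pM2l// qinner_norm.
    by rewrite ger0_norm ?sqr_ge0// expr2 ler_wpM2r.
  by rewrite (le_trans (lerD h3 h2))// le_eqVlt /c; apply/orP; left; apply/eqP; ring.
pose d0 := (2 * (b * c))^-1; have bc0 : 0 < b * c by rewrite mulr_gt0.
pose M0 := 2 * (b * c) * `|u p|.
pose M := M0 + (b * c * M0 + b * (a ^+ 2 * `|u p|)) + 1.
have M00 : 0 <= M0 by rewrite !mulr_ge0// ltW.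
have M1 : 0 <= b * c * M0 + b * (a ^+ 2 * `|u p|).
  by rewrite addr_ge0 ?mulr_ge0 ?exprn_ge0// ltW.
exists M, (Num.min (Num.min 1 e) d0); split.
- by rewrite /M ltr_wpDl// addr_ge0.
- by rewrite !lt_min ltr01 e0 invr_gt0 mulr_gt0.
- by rewrite !ge_min lexx.
move=> h; rewrite !lt_min => /andP[/andP[h1 he] hd].
have [_ _ K'] := op_inv_spec (inv h he).
set v := u (p + h); have h0 := normr_ge0 h.
have h1' := ltW h1; have v0 := normr_ge0 v.
have vE : v - u p = - B (incr p h v).
  apply/eqP; rewrite -addr_eq0 addrAC subr_eq0; apply/eqP.
  rewrite -{1}(BK v) -(rlin_add rB) -spencilD /u.
  by congr B; exact: K'.
have bch : b * c * `|h| <= 2^-1.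
  have : `|h| * (2 * (b * c)) < 1 by rewrite -ltr_pdivlMr ?mulr_gt0// div1r.
  lra.
have v2 : `|v| <= 2 * `|u p|.
  have : `|v| <= `|u p| + 2^-1 * `|v|.
    rewrite -{1}(subrK (u p) v) addrC (le_trans (ler_normD _ _))// lerD2l vE normrN.
    rewrite (le_trans (Bb _))//.
    apply: (@le_trans _ _ (b * (c * `|h| * `|v|))); first by rewrite ler_pM2l// incr_le.
    by rewrite !mulrA ler_wpM2r.
  by move: (`|u p|) (`|v|) => x y; lra.
have dv : `|v - u p| <= M0 * `|h|.
  rewrite vE normrN (le_trans (Bb _))//.
  apply: (@le_trans _ _ (b * (c * `|h| * `|v|))); first by rewrite ler_pM2l// incr_le.
  apply: (@le_trans _ _ (b * (c * `|h| * (2 * `|u p|)))).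
    by rewrite ler_pM2l// ler_wpM2l// mulr_ge0// ltW.
  by rewrite le_eqVlt /M0; apply/orP; left; apply/eqP; ring.
split.
  by rewrite (le_trans dv)// ler_wpM2r// /M -addrA lerDl addr_ge0.
have -> : v - u p - dresolvent p h
    = - B (incr p h (v - u p)) - `|h| ^+ 2 *: B (A (A (u p))).
  rewrite [X in X - dresolvent _ _]vE /dresolvent -/B.
  rewrite -(rlin_opp rB (incr p h v)) -(rlin_sub rB (- incr p h v)).
  rewrite -(rlin_opp rB (incr p h (v - u p))) -(rlin_scale rB (`|h| ^+ 2)).
  rewrite -(rlin_sub rB (- incr p h (v - u p))); congr B.
  rewrite /incr !(rlin_sub rA).
  by apply: redot_ext => z; rewrite !redotE; ring.
rewrite (le_trans (ler_normB _ _))// normrN.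
apply: (@le_trans _ _ ((b * c * M0 + b * (a ^+ 2 * `|u p|)) * `|h| ^+ 2)).
  rewrite mulrDl lerD//.
    rewrite (le_trans (Bb _))// -(mulrA (b * c)) -(mulrA b c) ler_pM2l//.
    rewrite (le_trans (incr_le _ _ h1'))// -(mulrA c `|h|) ler_pM2l//.
    by rewrite expr2 [leRHS]mulrCA ler_wpM2l.
  rewrite normrZ (@ger0_norm _ (`|h| ^+ 2)) ?sqr_ge0// mulrC ler_wpM2r ?sqr_ge0//.
  by rewrite (le_trans (Bb _))// ler_pM2l.
rewrite ler_wpM2r ?sqr_ge0// /M -addrA addrC -addrA.
by rewrite lerDl addr_ge0.
Qed.

End Resolvent.

(** * The Cauchy-Riemann equation *)

Section SliceFunction.
Variables (R : realType) (V : rqInnerType R) (A : V -> V) (w : V).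
Hypothesis A_bounded : bounded_operator A.
Variable phi : V -> quat R.
Hypothesis phiD : forall u v, phi (u + v) = phi u + phi v.
Hypothesis phiZ : forall x u, phi (x *: u) = x *: phi u.
Hypothesis phi_bounded : exists2 K : R, 0 < K & forall v, `|phi v| <= K * `|v|.
Variable delta : quat R.

Let u p := op_inv (spencil A p) w.
Let du p h := dresolvent A w p h.

(** The entries of the characteristic function have this form; [`|p| ^+ 2] is
    [p * qconj p]. *)
Definition slice_fun p : quat R :=
  delta - p * phi (u p) + `|p| ^+ 2 *: phi (A (u p)).

(** The Leibniz rule applied to [slice_fun] at [p], in the direction [h]. *)
Definition slice_diff p h : quat R :=
  - (h * phi (u p) + p * phi (du p h))
  + (2 * qinner p h) *: phi (A (u p)) + `|p| ^+ 2 *: phi (A (du p h)).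

Let phiB a b : phi (a - b) = phi a - phi b.
Proof. by rewrite -scaleN1r phiD phiZ scaleN1r. Qed.

Let rA := A_bounded.1.

Lemma slice_fun_remainder (p : quat R) (e : R) : 0 < e ->
  (forall h, `|h| < e -> boundedly_invertible (spencil A (p + h))) ->
  quadratic_remainder slice_fun p (slice_diff p).
Proof.
move=> e0 inv; have [a a0 Aa] := bop_pos A_bounded.
have [M [d [M0 d0 d1 rem]]] := resolvent_differentiable w A_bounded e0 inv.
have [K K0 Kphi] := phi_bounded.
exists (`|p| * (K * M) + K * M + `|p| ^+ 2 * (K * (a * M))
  + (2 * `|p| + 1) * (K * (a * M)) + K * (a * `|u p|)), d.
split=> // h hd; have [] := rem h hd; rewrite -/u.
set r := _ - u p; set r1 := r - _ => rM r1M.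
have h1 : `|h| <= 1 by rewrite (le_trans (ltW hd)).
have h0 := normr_ge0 h; have p0 := normr_ge0 p.
have uE : u (p + h) = u p + r by rewrite /r [RHS]addrC subrK.
have rE : r = du p h + r1 by rewrite /r1 /du [RHS]addrC subrK.
clearbody r1 r.
have -> : slice_fun (p + h) - slice_fun p - slice_diff p h =
  - (p * phi r1) - h * phi r + `|p| ^+ 2 *: phi (A r1)
  + (2 * qinner p h + `|h| ^+ 2) *: phi (A r) + `|h| ^+ 2 *: phi (A (u p)).
  rewrite /slice_fun /slice_diff uE (rlin_add rA (u p)) !phiD qnorm2D.
  have -> : phi (A r) = phi (A (du p h)) + phi (A r1).
    by rewrite {1}rE (rlin_add rA) phiD.
  have -> : phi r = phi (du p h) + phi r1 by rewrite {1}rE phiD.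
  move: (phi _) (phi _) (phi _) (phi (A _)) (phi (A _)) (phi (A _)).
  move: (qinner p h) (`|p| ^+ 2) (`|h| ^+ 2) => x y z a1 a2 a3 b1 b2 b3.
  by apply: quatP => /=; ring.
have nphi v : `|phi v| <= K * `|v| by [].
have nphiA v : `|phi (A v)| <= K * (a * `|v|).
  by rewrite (le_trans (nphi _))// ler_pM2l.
have Kn v x : `|v| <= x -> `|phi v| <= K * x.
  by move=> vx; rewrite (le_trans (nphi _))// ler_pM2l.
have KAn v x : `|v| <= x -> `|phi (A v)| <= K * (a * x).
  by move=> vx; rewrite (le_trans (nphiA _))// ler_pM2l// ler_pM2l.
have t1 : `|p * phi r1| <= `|p| * (K * M) * `|h| ^+ 2.
  by rewrite qnormM -!mulrA ler_wpM2l//; exact: Kn.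
have t2 : `|h * phi r| <= K * M * `|h| ^+ 2.
  by rewrite qnormM expr2 mulrA [leRHS]mulrC ler_wpM2l// -mulrA; exact: Kn.
have t3 : `| `|p| ^+ 2 *: phi (A r1)| <= `|p| ^+ 2 * (K * (a * M)) * `|h| ^+ 2.
  rewrite normrZ ger0_norm ?sqr_ge0// -(mulrA (`|p| ^+ 2)) ler_wpM2l ?sqr_ge0//.
  by rewrite -(mulrA K) -(mulrA a); exact: KAn.
have t4 : `|(2 * qinner p h + `|h| ^+ 2) *: phi (A r)|
    <= (2 * `|p| + 1) * (K * (a * M)) * `|h| ^+ 2.
  rewrite normrZ.
  have -> : (2 * `|p| + 1) * (K * (a * M)) * `|h| ^+ 2 =
    ((2 * `|p| + 1) * `|h|) * (K * (a * (M * `|h|))) by ring.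
  apply: ler_pM => //; last exact: KAn.
  apply: (le_trans (ler_normD _ _)); rewrite (mulrDl (2 * `|p|) 1); apply: lerD.
    by rewrite normrM (@ger0_norm _ 2)// -mulrA ler_pM2l// qinner_norm.
  by rewrite ger0_norm ?sqr_ge0// expr2 ler_wpM2r.
have t5 : `| `|h| ^+ 2 *: phi (A (u p))| <= K * (a * `|u p|) * `|h| ^+ 2.
  by rewrite normrZ ger0_norm ?sqr_ge0// mulrC ler_wpM2r ?sqr_ge0.
rewrite !(mulrDl _ _ (`|h| ^+ 2)).
do 3 rewrite (le_trans (ler_normD _ _)) ?lerD//.
by rewrite (le_trans (ler_normD _ _)) ?lerD// normrN.
Qed.

Lemma slice_diff_linear p : boundedly_invertible (spencil A p) ->
  linear (slice_diff p).
Proof.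
case/op_inv_spec => -[rB _] _ _ x h k; rewrite /slice_diff.
have -> : du p (x *: h + k) = x *: du p h + du p k.
  rewrite /du /dresolvent -(rlin_scale rB) -(rlin_add rB); congr op_inv.
  by apply: redot_ext => z; rewrite !redotE /qinner /=; ring.
rewrite (rlin_add rA) (rlin_scale rA) !(phiD, phiZ).
by apply: quatP; rewrite /qinner /=; ring.
Qed.

Lemma slice_diff_bounded p : boundedly_invertible (spencil A p) ->
  exists K : R, forall h, `|slice_diff p h| <= K * `|h|.
Proof.
move=> ip; have lin := slice_diff_linear ip.
pose one := Quat 1 0 0 0 : quat R; pose qi1 := Quat 0 1 0 0 : quat R.
pose qj1 := Quat 0 0 1 0 : quat R; pose qk1 := Quat 0 0 0 1 : quat R.
pose L := slice_diff p.
have LZ x h : L (x *: h) = x *: L h.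
  have := lin x h 0; rewrite addr0 -/L => ->.
  have := lin 0 0 0; rewrite -/L scaler0 addr0 scale0r add0r => L0.
  have := lin (-1) 0 0; rewrite -/L scaler0 addr0 scaleN1r addNr => ->.
  by rewrite addr0.
have LD h k : L (h + k) = L h + L k.
  by have := lin 1 h k; rewrite !scale1r.
exists (`|L one| + `|L qi1| + `|L qj1| + `|L qk1|) => h; rewrite -/L.
have hE : h = qre h *: one + qi h *: qi1 + qj h *: qj1 + qk h *: qk1.
  by apply: quatP => /=; ring.
have coef (x : R) k : x ^+ 2 <= qinner h h -> `|L (x *: k)| <= `|L k| * `|h|.
  move=> xh; rewrite LZ normrZ mulrC ler_wpM2l// -sqrtr_sqr qnormE.
  by rewrite ler_sqrt// qinner_ge0.
have [sr si sj sk] : [/\ qre h ^+ 2 <= qinner h h, qi h ^+ 2 <= qinner h h,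
    qj h ^+ 2 <= qinner h h & qk h ^+ 2 <= qinner h h].
  have := (sqr_ge0 (qre h), sqr_ge0 (qi h), sqr_ge0 (qj h), sqr_ge0 (qk h)).
  by rewrite /qinner => -[[[]]] *; split; lra.
rewrite {1}hE !LD !mulrDl.
do 3 (apply: (le_trans (ler_normD _ _)); apply: lerD; last exact: coef).
exact: coef.
Qed.

(** With [p = x + I y], the sum of the differential along [1] and of [I] times the
    differential along [I] is [2 p phi (A u - A B_p T_p u)], where [u] is the
    value of the resolvent; it vanishes because [B_p] inverts [T_p]. *)
Lemma slice_diff_CR p I : im_sphere I -> I * p = p * I ->
  p = (qre p)%:H + I * (qinner p I)%:H -> boundedly_invertible (spencil A p) ->
  slice_diff p 1 + I * slice_diff p I = 0.
Proof.
move=> I1 pI pE ip; have [[rB _] BK KB] := op_inv_spec ip.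
set y := qinner p I in pE.
have II := im_sphere_sqr I1; have [I0 _] := I1.
pose B := op_inv (spencil A p); rewrite -/B in rB BK KB.
have rP := (spencil_bounded A_bounded p).1.
have AB v : A (B v) = B (A v).
  by rewrite -[RHS](congr1 B (congr1 A (KB v))) spencil_comm// BK.
have uE : u p = B (u p) - (2 * qre p) *: B (A (u p)) + `|p| ^+ 2 *: B (A (A (u p))).
  rewrite -!(rlin_scale rB) -(rlin_sub rB) -(rlin_add rB).
  by rewrite -[X in B X]/(spencil A p (u p)) BK.
have D1 : du p 1 = 2 *: B (A (u p)) - (2 * qre p) *: B (A (A (u p))).
  rewrite /du /dresolvent -/B -/(u p) (rlin_sub rB) !(rlin_scale rB) /=.
  by rewrite mulr1 /qinner /= !mulr0 !addr0 mulr1.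
have DI : du p I = - ((2 * y) *: B (A (A (u p)))).
  rewrite /du /dresolvent -/B -/(u p) (rlin_sub rB) !(rlin_scale rB) /=.
  by rewrite I0 mulr0 scale0r sub0r.
have q1 : qinner p 1 = qre p by rewrite /qinner /= mulr1 !mulr0 !addr0.
rewrite /slice_diff D1 DI q1 -/y (rlin_sub rA) (rlin_opp rA) !(rlin_scale rA).
move: uE; move: (u p) => v uE.
have phiN z : phi (- z) = - phi z by rewrite -scaleN1r phiZ scaleN1r.
pose a := phi (A (v)); pose b := phi (B (A (v))).
pose c := phi (B (A (A (v)))); pose d := phi (B (A (A (A (v))))).
have rel : a = b - (2 * qre p) *: c + `|p| ^+ 2 *: d.
  rewrite /a {1}uE (rlin_add rA) (rlin_sub rA) !(rlin_scale rA).
  by rewrite phiD phiB !phiZ !AB.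
rewrite !phiB !phiN !phiZ !AB -/a -/b -/c -/d; set f := phi v.
have n2 : `|p| ^+ 2 = qre p ^+ 2 + y ^+ 2.
  rewrite pE qnorm2 /qinner /= I0; have := qnorm2 I.
  case: I1 => _ ->; rewrite expr1n /qinner I0 => h.
  by rewrite -[y ^+ 2]mul1r h; ring.
have IIz z : I * (I * z) = - z by rewrite mulrA II mulN1r.
have Ix (x : R) z : I * (x *: z) = x *: (I * z).
  by rewrite !qscaleE mulrA qrealC -mulrA.
have pz z : p * z = qre p *: z + y *: (I * z).
  by rewrite [in LHS]pE mulrDl qrealC -mulrA !qscaleE.
rewrite rel n2 !pz mul1r !(mulrDr I, mulrN I, Ix, IIz).
move: (I * b) (I * c) (I * d) (I * f) => b' c' d' f'.
by apply: quatP => /=; ring.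
Qed.

End SliceFunction.

(** * Matrices of operators, and slice hyperholomorphy of the characteristic function *)

Section MatrixOfOperator.
Variable R : realType.

Lemma qvec_rscaleE m (c : qvec R m) a i : (c :* a) i 0 = c i 0 * a.
Proof. exact: qvrscaleE. Qed.

Lemma qvec_basis m (c : qvec R m) :
  c = \sum_k (delta_mx k 0 : qvec R m) :* c k 0.
Proof.
apply/colP => i; rewrite summxE (bigD1 i)//= big1 => [|k ki].
  by rewrite qvec_rscaleE mxE !eqxx mul1r addr0.
by rewrite qvec_rscaleE mxE eq_sym (negbTE ki) mul0r.
Qed.

Lemma mx_of_opE m n (T : qvec R n -> qvec R m) (c : qvec R n) :
  right_linear T -> T c = mx_of_op T *m c.
Proof.
move=> rT; rewrite [in LHS](qvec_basis c) (rlin_sum rT).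
apply/colP => i; rewrite summxE mxE; apply: eq_bigr => k _.
by rewrite (rlin_rscale rT) qvec_rscaleE mxE.
Qed.

Lemma mx_of_op_comp m n r (T : qvec R n -> qvec R m) (S : qvec R r -> qvec R n) :
  right_linear T -> mx_of_op T *m mx_of_op S = mx_of_op (T \o S).
Proof.
move=> rT; apply/matrixP => i j; rewrite [RHS]mxE /= mx_of_opE// !mxE.
by apply: eq_bigr => k _; rewrite !mxE.
Qed.

Lemma mulmx_right_linear m n (M : 'M[quat R]_(m, n)) :
  right_linear (fun c : qvec R n => M *m c : qvec R m).
Proof.
split=> [c d|c a]; first exact: mulmxDr.
by rewrite /rscale /= /qvrscale /mxrscale mulmxA.
Qed.

Lemma mx_of_mulmx m n (M : 'M[quat R]_(m, n)) :
  mx_of_op (fun c : qvec R n => M *m c : qvec R m) = M.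
Proof.
apply/matrixP => i j; rewrite mxE mxE (bigD1 j)//= big1 => [|k kj].
  by rewrite mxE !eqxx mulr1 addr0.
by rewrite mxE (negbTE kj) mulr0.
Qed.

Lemma mx_of_opD m n (T S : qvec R n -> qvec R m) :
  mx_of_op (fun c => T c + S c) = mx_of_op T + mx_of_op S.
Proof. by apply/matrixP => i j; rewrite !mxE. Qed.

Lemma mx_of_opN m n (T : qvec R n -> qvec R m) :
  mx_of_op (fun c => - T c) = - mx_of_op T.
Proof. by apply/matrixP => i j; rewrite !mxE. Qed.

Lemma mx_of_opZ m n x (T : qvec R n -> qvec R m) :
  mx_of_op (fun c => x *: T c) = x%:H *: mx_of_op T.
Proof. by apply/matrixP => i j; rewrite !mxE qscaleE. Qed.

Lemma qdot_delta m (c : qvec R m) i : qdot c (delta_mx i 0 : qvec R m) = c i 0.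
Proof.
rewrite -[qdot _ _]/(qvdot _ _) qvdotE (bigD1 i)//= big1 => [|k ki].
  by rewrite mxE !eqxx addr0 -[1]/(1%:H) qconj_real mul1r.
by rewrite mxE (negbTE ki) qconj0 mul0r.
Qed.

Lemma mxadj_of_op m n (T : qvec R n -> qvec R m) Ts :
  adjoint_of T Ts -> mxadj (mx_of_op T) = mx_of_op Ts.
Proof.
move=> aT; apply/matrixP => i j; rewrite !mxE.
by rewrite -!qdot_delta aT -qdotC.
Qed.

End MatrixOfOperator.

Section CharFunSlice.
Variables (R : realType) (V : rqInnerType R) (m : nat).
Variables (A : V -> V) (C : qvec R m -> V) (Cs : V -> qvec R m) (J : 'M[quat R]_m).
Hypotheses (A_bounded : bounded_operator A) (C_lin : right_linear C).
Hypothesis Cs_bounded : bounded_operator Cs.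

Lemma qvec_coord_norm (c : qvec R m) i : `|c i 0| <= `|c|.
Proof.
rewrite qnormE /Num.norm /= /qvnorm ler_sqrt ?qvinner_ge0// /qvinner.
by rewrite (bigD1 i)//= lerDl sumr_ge0// => k _; exact: qinner_ge0.
Qed.

Lemma char_fun_entry p i j : boundedly_invertible (spencil A p) ->
  char_fun A C Cs J p i j
  = slice_fun A (C (col j J)) (fun v => Cs v i 0) (i == j)%:R p.
Proof.
move=> /op_inv_spec[[rB _] _ _]; have rA := A_bounded.1.
have rCs := Cs_bounded.1.
have mxJ (T : qvec R m -> qvec R m) : right_linear T ->
    (mx_of_op T *m J) i j = T (col j J) i 0.
  move=> rT; rewrite (mx_of_opE (col j J) rT) mxE [RHS]mxE.
  by apply: eq_bigr => k _; rewrite [col j J k 0]mxE.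
have entries (X Y : 'M[quat R]_m) : (1%:M - p *: (X - qconj p *: Y)) i j
    = (i == j)%:R - p * (X i j - qconj p * Y i j) by rewrite !mxE.
rewrite /char_fun /star_resolvent mulmxBl -scalemxAl entries.
rewrite (mxJ _ (rlin_comp rCs (rlin_comp rB C_lin))).
rewrite (mxJ _ (rlin_comp rCs (rlin_comp rA (rlin_comp rB C_lin)))) /=.
by rewrite /slice_fun mulrBr opprB addrA addrAC mulrA qmulqc qscaleE.
Qed.

(** The entries of the characteristic function are the functions [slice_fun], with
    [phi] a coordinate of [Cs] and [w] a column of [C J]. *)
Lemma char_fun_slice (Omega : set (quat R)) : open Omega ->
  Omega `<=` char_fun_dom A -> left_slice_hyperholomorphic Omega (char_fun A C Cs J).
Proof.
move=> oO OD.
have key p i j : Omega p ->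
    let L := slice_diff A (C (col j J)) (fun v => Cs v i 0) p in
    differentiable (fun q => char_fun A C Cs J q i j) p /\
    'd (fun q => char_fun A C Cs J q i j) p = L :> (quat R -> quat R).
  move=> Op L; have /nbhs_normP[e /= e0 He] := open_nbhs_nbhs (conj oO Op).
  have inv h : `|h| < e -> boundedly_invertible (spencil A (p + h)).
    by move=> he; apply/OD/He; rewrite /= opprD addrA subrr sub0r normrN.
  have phiD u v : (Cs (u + v)) i 0 = Cs u i 0 + Cs v i 0.
    by rewrite (rlin_add Cs_bounded.1) mxE.
  have phiZ x u : (Cs (x *: u)) i 0 = x *: Cs u i 0.
    by rewrite (rlin_scale Cs_bounded.1) mxE.
  have phiK : exists2 K : R, 0 < K & forall v, `|Cs v i 0| <= K * `|v|.
    have [K K0 CK] := bop_pos Cs_bounded; exists K => // v.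
    by rewrite (le_trans (qvec_coord_norm _ _)).
  have ip := OD p Op.
  have [K LK] := @slice_diff_bounded _ _ _ (C (col j J)) A_bounded _ phiD phiZ _ ip.
  apply: (quadratic_remainder_diff (K := K)) => //.
    exact: slice_diff_linear.
  have [M [d [d0 rem]]] := @slice_fun_remainder _ _ _ (C (col j J)) A_bounded _
    phiD phiK (i == j)%:R p e e0 inv.
  exists M, (Num.min d e); split; first by rewrite lt_min d0.
  move=> h; rewrite lt_min => /andP[hd he].
  move: (rem h hd); have <- := char_fun_entry i j (inv h he).
  by have <- := char_fun_entry i j ip.
split=> [p i j Op|I x y i j I1 Op]; first by have [] := key p i j Op.
have [dS LE] := key _ i j Op.
have l1 h : spt I (h + x) y = h *: (1 : quat R) + spt I x y.
  by rewrite /spt; apply: quatP => /=; ring.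
have l2 h : spt I x (h + y) = h *: I + spt I x y :> quat R.
  by rewrite /spt; apply: quatP => /=; ring.
pose f q := char_fun A C Cs J q i j.
have D1 := @derive1_along_line _ _ _ f (fun t => spt I t y) x 1 l1 dS.
have D2 := @derive1_along_line _ _ _ f (fun t => spt I x t) y I l2 dS.
rewrite [X in X + _]D1 [X in I * X]D2 LE.
apply: slice_diff_CR => //.
- by move=> u v; rewrite (rlin_add Cs_bounded.1) mxE.
- by move=> a u; rewrite (rlin_scale Cs_bounded.1) mxE.
- by rewrite /spt mulrDr mulrDl qrealC -mulrA qrealC.
- rewrite spt_re// /spt; congr (_ + _ * _%:H).
  have := qnorm2 I; case: (I1) => I0 ->; rewrite expr1n /qinner I0 /= I0 => h.
  by rewrite -[LHS]mulr1 h; ring.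
- exact: OD.
Qed.

End CharFunSlice.

(** * Components of star products and of the half-space kernel *)

Section StarParts.
Variable R : realType.
Implicit Types (p q : quat R) (x y : R).

Lemma half_double m n (M : 'M[quat R]_(m, n)) : (2^-1)%:H *: (M + M) = M.
Proof.
by apply/matrixP => i j; rewrite !mxE; apply: quatP => /=; field.
Qed.

Lemma mxrscaleE m n (M : 'M[quat R]_(m, n)) a i j : mxrscale M a i j = M i j * a.
Proof.
rewrite mxE (bigD1 j)//= big1 => [|k kj]; first by rewrite mxE eqxx addr0.
by rewrite mxE (negbTE kj) mulr0.
Qed.

(** The hypothesis [I I b = - b] stands for [I I = -1] when [p] is not real, and
    for [b = 0] when [p] is real, where [im_dir p = 0]. *)
Lemma left_parts m n (f : quat R -> 'M[quat R]_(m, n)) p a b :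
  f p = a + im_dir p *: b -> f (qconj p) = a - im_dir p *: b ->
  im_dir p *: (im_dir p *: b) = - b ->
  even_part f p = a /\ lodd_part f p = b.
Proof.
move=> fp fq IIb; rewrite /even_part /lodd_part fp fq; split.
  by rewrite addrACA subrr addr0 half_double.
rewrite opprD addrACA subrr add0r -opprD scalerN scalerDr IIb opprD opprK.
exact: half_double.
Qed.

Lemma right_parts m n (f : quat R -> 'M[quat R]_(m, n)) p a b :
  f p = a + mxrscale b (im_dir p) -> f (qconj p) = a - mxrscale b (im_dir p) ->
  mxrscale (mxrscale b (im_dir p)) (im_dir p) = - b ->
  even_part f p = a /\ rodd_part f p = b.
Proof.
move=> fp fq IIb; rewrite /even_part /rodd_part fp fq; split.
  by rewrite addrACA subrr addr0 half_double.
rewrite opprD addrACA subrr add0r -opprD.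
have -> : mxrscale (- (mxrscale b (im_dir p) + mxrscale b (im_dir p))) (im_dir p)
    = b + b.
  apply/matrixP => i j; have := congr1 (fun M : 'M[quat R]_(m, n) => M i j) IIb.
  by rewrite !(mxrscaleE, mxE) mulNr mulrDl => ->; rewrite -opprD opprK.
exact: half_double.
Qed.

Lemma im_dir2_abs m n p (M : 'M[quat R]_(m, n)) :
  im_dir p *: (im_dir p *: ((im_abs p)%:H *: M)) = - ((im_abs p)%:H *: M).
Proof. by rewrite !scalerA im_dir_abs scaleNr. Qed.

End StarParts.

Section KernelCoefficients.
Variable R : realType.
Implicit Types (s y v : R).

(** The functions [kee], [koe], [keo], [koo] are the coefficients of
    [1 / (s + i y + l v)] in the basis [1, i, l, i l], when [i] and [l] are
    commuting square roots of [-1]: with [s = x + u], this is the kernel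
    [1 / (z + w)] at [z = x + i y] and [w = u + l v]. The denominator is the
    product of the four conjugates of [s + i y + l v]. *)
Definition kden s y v : R := (s ^+ 2 + y ^+ 2 - v ^+ 2) ^+ 2 + (2 * s * v) ^+ 2.
Definition kee s y v : R := s * (s ^+ 2 + y ^+ 2 + v ^+ 2) / kden s y v.
Definition koe s y v : R := - (y * (s ^+ 2 + y ^+ 2 - v ^+ 2)) / kden s y v.
Definition keo s y v : R := v * (y ^+ 2 - s ^+ 2 - v ^+ 2) / kden s y v.
Definition koo s y v : R := 2 * y * s * v / kden s y v.

Lemma kden_neq0 s y v : 0 < s -> kden s y v != 0.
Proof.
move=> s0; rewrite /kden paddr_eq0 ?sqr_ge0// !sqrf_eq0.
have [->|v0] := eqVneq v 0.
  by rewrite expr0n subr0 gt_eqF// ltr_wpDr ?sqr_ge0// exprn_gt0.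
have /negbTE -> : 2 * s * v != 0 by rewrite !mulf_neq0// gt_eqF.
by rewrite andbF.
Qed.

(** The products of the four components with [s + i y + l v] are undone by
    multiplying with the components of its inverse. *)
Lemma kernel_solve s y v (a b c d wee woe weo woo : quat R) : 0 < s ->
  wee = s *: a - y *: b - v *: c -> woe = s *: b + y *: a - v *: d ->
  weo = s *: c + v *: a - y *: d -> woo = s *: d + y *: c + v *: b ->
  [/\ kee s y v *: wee - keo s y v *: weo - koe s y v *: woe + koo s y v *: woo = a,
      kee s y v *: woe - keo s y v *: woo + koe s y v *: wee - koo s y v *: weo = b,
      kee s y v *: weo + keo s y v *: wee - koe s y v *: woo - koo s y v *: woe = c
    & kee s y v *: woo + keo s y v *: woe + koe s y v *: weo + koo s y v *: wee = d].
Proof.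
move=> s0 -> -> -> ->; have := kden_neq0 y v s0.
rewrite /kee /koe /keo /koo /kden => n0.
by split; apply: quatP => /=; field.
Qed.

(** The denominator of [kker p q] lies in the complex line of [conj q], so the
    coefficient of [conj q] stays on the right and that of [p] on the left, as the
    two star products require. *)
Lemma kker_split (p q : quat R) : 0 < qre p + qre q ->
  let s := qre p + qre q in let y := im_abs p in let v := im_abs q in
  kker p q = (kee s y v)%:H + im_dir p * (koe s y v)%:H
    + ((keo s y v)%:H + im_dir p * (koo s y v)%:H) * im_dir (qconj q).
Proof.
move=> s0 s y v; have n0 := kden_neq0 y v s0.
set I := im_dir p; set L := im_dir (qconj q).
have qE : qconj q = (qre q)%:H + L * v%:H.
  by rewrite {1}[qconj q]polar im_abs_conj.
have pE : qconj p = (qre p)%:H - I * y%:H.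
  by rewrite {1}[qconj p]polar im_abs_conj im_dir_conj mulNr.
have LLv : L * L * v%:H = - v%:H by rewrite /v -im_abs_conj im_dir_abs.
have LLvx x : L * L * (v * x)%:H = - (v * x)%:H.
  by rewrite qrealM mulrA LLv mulNr.
(* the denominator [(s + l v)^2 + y^2] is [al + l be] *)
pose al := s ^+ 2 + y ^+ 2 - v ^+ 2; pose be := 2 * s * v.
have DE : (`|p| ^+ 2)%:H + (2 * qre p)%:H * qconj q + qconj q ^+ 2
    = al%:H + L * be%:H.
  rewrite qE qnorm2_polar -/y.
  have -> : ((qre q)%:H + L * v%:H) ^+ 2
      = (qre q ^+ 2)%:H + L * (2 * qre q * v)%:H + L * L * (v * v)%:H.
    by rewrite expr2; apply: quatP => /=; ring.
  rewrite LLvx /al /be /s; apply: quatP => /=; ring.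
have Dn0 : al%:H + L * be%:H != 0.
  have : (al%:H + L * be%:H) * (al%:H - L * be%:H) = (kden s y v)%:H.
    have -> : (al%:H + L * be%:H) * (al%:H - L * be%:H)
        = (al ^+ 2)%:H - L * L * (be * be)%:H.
      by apply: quatP => /=; ring.
    have -> : be * be = v * (2 * s * be) by rewrite /be; ring.
    rewrite LLvx opprK -qrealD; congr qreal; rewrite /kden /be -/al; ring.
  move=> h; apply/eqP => d0; move: h; rewrite d0 mul0r => -[] /esym/eqP.
  by rewrite (negbTE n0).
have Du : al%:H + L * be%:H \is a GRing.unit by exact: Dn0.
rewrite /kker DE; apply: (mulIr Du); rewrite (divrK Du).
have expand (a b : quat R) : (a + b * L) * (al%:H + L * be%:H)
    = a * al%:H + b * (L * L * be%:H) + (a * be%:H + b * al%:H) * L.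
  by apply: quatP => /=; ring.
rewrite expand; move: expand => _.
have -> : L * L * be%:H = - be%:H.
  by have -> : be = v * (2 * s) by rewrite /be; ring; exact: LLvx.
have e1 : kee s y v * al - keo s y v * be = s.
  by move: n0; rewrite /kee /keo /kden /al /be => n0; field.
have e2 : koe s y v * al - koo s y v * be = - y.
  by move: n0; rewrite /koe /koo /kden /al /be => n0; field.
have e3 : kee s y v * be + keo s y v * al = v.
  by move: n0; rewrite /kee /keo /kden /al /be => n0; field.
have e4 : koe s y v * be + koo s y v * al = 0.
  by move: n0; rewrite /koe /koo /kden /al /be => n0; field.
move: (kee s y v) (koe s y v) (keo s y v) (koo s y v) e1 e2 e3 e4 => a b c d e1 e2 e3 e4.
have -> : (a%:H + I * b%:H) * al%:H + (c%:H + I * d%:H) * - be%:H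
    + ((a%:H + I * b%:H) * be%:H + (c%:H + I * d%:H) * al%:H) * L
  = (a * al - c * be)%:H + I * (b * al - d * be)%:H
    + ((a * be + c * al)%:H + I * (b * be + d * al)%:H) * L.
  by apply: quatP => /=; ring.
by rewrite e1 e2 e3 e4 qE pE; apply: quatP => /=; rewrite /s; ring.
Qed.

End KernelCoefficients.

(** * The kernel of the characteristic function *)

Section MatrixScaling.
Variable R : realType.

Lemma mulmx_real m n r (M : 'M[quat R]_(m, n)) (x : R) (N : 'M[quat R]_(n, r)) :
  M *m (x%:H *: N) = x%:H *: (M *m N).
Proof.
apply/matrixP => i j; rewrite !mxE mulr_sumr; apply: eq_bigr => k _.
by rewrite mxE mulrA qrealC mulrA.
Qed.

Lemma mxadjM m n r (M : 'M[quat R]_(m, n)) (N : 'M[quat R]_(n, r)) :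
  mxadj (M *m N) = mxadj N *m mxadj M.
Proof.
apply/matrixP => i j; rewrite !mxE qconj_sum; apply: eq_bigr => k _.
by rewrite !mxE qconjM.
Qed.

Lemma mxadjB m n (M N : 'M[quat R]_(m, n)) : mxadj (M - N) = mxadj M - mxadj N.
Proof. by apply/matrixP => i j; rewrite !mxE qconjD qconjN. Qed.

Lemma mxadjD m n (M N : 'M[quat R]_(m, n)) : mxadj (M + N) = mxadj M + mxadj N.
Proof. by apply/matrixP => i j; rewrite !mxE qconjD. Qed.

Lemma mxadj1 m : mxadj (1%:M : 'M[quat R]_m) = 1%:M.
Proof.
apply/matrixP => i j; rewrite !mxE eq_sym.
by case: eqP => _; [exact: (qconj_real 1)|exact: qconj0].
Qed.

Lemma mxadjK m n (M : 'M[quat R]_(m, n)) : mxadj (mxadj M) = M.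
Proof. by apply/matrixP => i j; rewrite !mxE qconjK. Qed.

Lemma mxadj_scale m n (M : 'M[quat R]_(m, n)) a :
  mxadj (a *: M) = mxrscale (mxadj M) (qconj a).
Proof. by apply/matrixP => i j; rewrite mxrscaleE !mxE qconjM. Qed.

Lemma mxrscale_real m n (M : 'M[quat R]_(m, n)) (x : R) :
  mxrscale M x%:H = x%:H *: M.
Proof. by apply/matrixP => i j; rewrite mxrscaleE mxE qrealC. Qed.

Lemma mxadj_congruence m (U D : 'M[quat R]_m) :
  mxadj (U *m D *m mxadj U) = U *m mxadj D *m mxadj U.
Proof. by rewrite mxadjM mxadjM mxadjK mulmxA. Qed.

Lemma real_signature_adj m (J : 'M[quat R]_m) : real_signature_mx J -> mxadj J = J.
Proof.
case=> r [U [_ ->]]; set e := \row_i _.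
have -> : mxadj (U *m diag_mx e *m mxadj U) = U *m mxadj (diag_mx e) *m mxadj U.
  exact: mxadj_congruence.
have -> // : mxadj (diag_mx e) = diag_mx e.
apply/matrixP => i j; rewrite /e !mxE [j == i]eq_sym.
case: eqP => [->|_]; last by rewrite !mulr0n qconj0.
by rewrite !mulr1n; case: ifP => _; rewrite ?qconjN -[1]/(1%:H) qconj_real.
Qed.

Lemma real_signature_sqr m (J : 'M[quat R]_m) : real_signature_mx J -> J *m J = 1%:M.
Proof.
case=> r [U [[UU UU'] ->]]; set D := diag_mx _.
have DD : D *m D = 1%:M.
  rewrite mulmx_diag -diag_const_mx; congr diag_mx; apply/rowP => i; rewrite !mxE.
  by case: ifP => _; rewrite ?mulr1 ?mulrNN ?mulr1.
by rewrite -!mulmxA (mulmxA (mxadj U)) UU mul1mx (mulmxA D) DD mul1mx.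
Qed.

End MatrixScaling.

Section Entries.
Variables (R : realType) (M : zmodType).
Variables (lsc : quat R -> M -> M) (rsc : M -> quat R -> M).

(** The matrices below are combinations of a few blocks with quaternionic
    coefficients on either side. The identities between them are proved for one
    entry [e] at a time, over an abstract module: only linearity matters, and
    nothing unfolds the matrix and quaternion operations. *)
Definition bilinear_entry (e : M -> quat R) :=
  [/\ forall N N', e (N + N') = e N + e N', forall N, e (- N) = - e N,
      forall a N, e (lsc a N) = a * e N & forall a N, e (rsc N a) = e N * a].

Variable e : M -> quat R.
Hypothesis e_entry : bilinear_entry e.

Let eD N N' : e (N + N') = e N + e N'. Proof. by case: e_entry. Qed.
Let eN N : e (- N) = - e N. Proof. by case: e_entry. Qed.
Let eL a N : e (lsc a N) = a * e N. Proof. by case: e_entry. Qed.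
Let eR N a : e (rsc N a) = e N * a. Proof. by case: e_entry. Qed.
Let eX x N : e (lsc x%:H N) = x *: e N. Proof. by rewrite eL qscaleE. Qed.

Lemma split_entry (h k : M) (a b c d : R) (I L : quat R) :
  e (lsc (a%:H + I * b%:H) h - lsc (c%:H + I * d%:H) k
     + rsc (lsc (a%:H + I * b%:H) k + lsc (c%:H + I * d%:H) h) L)
  = e (lsc a%:H h - lsc c%:H k + rsc (lsc a%:H k + lsc c%:H h) L
       + lsc I (lsc b%:H h - lsc d%:H k + rsc (lsc b%:H k + lsc d%:H h) L)).
Proof.
rewrite !(eD, eN, eX, eL, eR) !qrealC !mulrDl -!mulrA -!qscaleE.
move: (e h) (e k) => t1 t2.
by apply: quatP => /=; ring.
Qed.

Lemma square_entry (h k : M) (b d : R) (I L : quat R) :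
  (forall t, I * (I * (b%:H * t)) = - (b%:H * t)) ->
  (forall t, I * (I * (d%:H * t)) = - (d%:H * t)) ->
  let N := lsc b%:H h - lsc d%:H k + rsc (lsc b%:H k + lsc d%:H h) L in
  e (lsc I (lsc I N)) = e (- N).
Proof.
move=> IIb IId N; rewrite !(eL, eN) /N !(eD, eN, eL, eR).
by rewrite mulrDl -!mulrA !(mulrDr, mulrN) !IIb !IId !opprD.
Qed.

Variables (p00 p10 p01 p11 p02 p20 p12 p21 J : M) (x y u v : R).
(* [f0], [f1] are the coefficients [C^* B_p C], [C^* A B_p C] of [S] at [p];
   [g0], [g1] are the adjoints of those at [q]; [x00], .., [x11] are the products
   [f0 J g0], .., [f1 J g1]. *)
Variables (f0 f1 g0 g1 x00 x01 x10 x11 mee moe meo moo : M).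
Hypothesis f0E : f0 = p00 - lsc (2 * u)%:H p01 + lsc (u ^+ 2 + v ^+ 2)%:H p02.
Hypothesis f1E : f1 = p10 - lsc (2 * u)%:H p11 + lsc (u ^+ 2 + v ^+ 2)%:H p12.
Hypothesis g0E : g0 = p00 - lsc (2 * x)%:H p10 + lsc (x ^+ 2 + y ^+ 2)%:H p20.
Hypothesis g1E : g1 = p01 - lsc (2 * x)%:H p11 + lsc (x ^+ 2 + y ^+ 2)%:H p21.
Hypothesis x00E : x00 = - (p10 + p01).
Hypothesis x01E : x01 = - (p11 + p02).
Hypothesis x10E : x10 = - (p20 + p11).
Hypothesis x11E : x11 = - (p21 + p12).
Hypothesis meeE : mee = J - lsc u%:H g0 + lsc (u ^+ 2 + v ^+ 2)%:H g1
  - (lsc x%:H f0 - lsc x%:H (lsc u%:H x00) + lsc x%:H (lsc (u ^+ 2 + v ^+ 2)%:H x01))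
  + (lsc (x ^+ 2 + y ^+ 2)%:H f1 - lsc (x ^+ 2 + y ^+ 2)%:H (lsc u%:H x10)
     + lsc (x ^+ 2 + y ^+ 2)%:H (lsc (u ^+ 2 + v ^+ 2)%:H x11)).
Hypothesis moeE : moe = - (lsc y%:H f0 - lsc y%:H (lsc u%:H x00)
  + lsc y%:H (lsc (u ^+ 2 + v ^+ 2)%:H x01)).
Hypothesis meoE : meo = - lsc v%:H g0 + lsc x%:H (lsc v%:H x00)
  - lsc (x ^+ 2 + y ^+ 2)%:H (lsc v%:H x10).
Hypothesis mooE : moo = lsc y%:H (lsc v%:H x00).

Variables (I L : quat R).
Hypothesis s_pos : 0 < x + u.
Let a := kee (x + u) y v.
Let b := koe (x + u) y v.
Let c := keo (x + u) y v.
Let d := koo (x + u) y v.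

(** The left-hand side is [(J - S(z) J S(w)^* ) / (z + w)] in components: [mee],
    [moe], [meo], [moo] are those of [S(z) J S(w)^*], expanded in the hypotheses.
    With [z z* = x^2 + y^2], [z + z* = 2 x] and likewise for [w], the coefficients
    of [p20], [p02], [p21], [p12] cancel, and the other ones are multiples of
    [z + w]. *)
Lemma kernel_entry :
  e (rsc J (a%:H + c%:H * L) + lsc I (rsc J (b%:H + d%:H * L))
     - ((lsc a%:H mee - lsc c%:H meo + rsc (lsc a%:H meo + lsc c%:H mee) L
         - (lsc b%:H moe - lsc d%:H moo + rsc (lsc b%:H moo + lsc d%:H moe) L))
        + lsc I (lsc b%:H mee - lsc d%:H meo + rsc (lsc b%:H meo + lsc d%:H mee) L
         + (lsc a%:H moe - lsc c%:H moo + rsc (lsc a%:H moo + lsc c%:H moe) L))))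
  = e (p00 - lsc (x%:H - I * y%:H) p10 - rsc p01 (u%:H - L * v%:H)
       + lsc (x%:H - I * y%:H) (rsc p11 (u%:H - L * v%:H))).
Proof.
pose qee := e p00 - x *: e p10 - u *: e p01 + (x * u) *: e p11.
pose qoe := y *: e p10 - (y * u) *: e p11.
pose qeo := v *: e p01 - (x * v) *: e p11.
pose qoo := (y * v) *: e p11.
pose wee := (x + u) *: qee - y *: qoe - v *: qeo.
pose woe := (x + u) *: qoe + y *: qee - v *: qoo.
pose weo := (x + u) *: qeo + v *: qee - y *: qoo.
pose woo := (x + u) *: qoo + y *: qeo + v *: qoe.
have Eee : e mee = e J - wee.
  rewrite meeE f0E f1E g0E g1E x00E x01E x10E x11E !(eD, eN, eX) /wee /qee /qoe /qeo.
  move: (e p00) (e p10) (e p01) (e p11) (e p02) (e p20) (e p12) (e p21) (e J).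
  by move=> *; apply: quatP => /=; ring.
have Eoe : e moe = - woe.
  rewrite moeE f0E x00E x01E !(eD, eN, eX) /woe /qee /qoe /qoo.
  move: (e p00) (e p10) (e p01) (e p11) (e p02).
  by move=> *; apply: quatP => /=; ring.
have Eeo : e meo = - weo.
  rewrite meoE g0E x00E x10E !(eD, eN, eX) /weo /qee /qeo /qoo.
  move: (e p00) (e p10) (e p01) (e p11) (e p20).
  by move=> *; apply: quatP => /=; ring.
have Eoo : e moo = - woo.
  rewrite mooE x00E !(eD, eN, eX) /woo /qoe /qeo /qoo.
  move: (e p10) (e p01) (e p11).
  by move=> *; apply: quatP => /=; ring.
have [S1 S2 S3 S4] := kernel_solve s_pos (erefl wee) (erefl woe) (erefl weo) (erefl woo).
rewrite -/a -/b -/c -/d in S1 S2 S3 S4.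
have -> : e (p00 - lsc (x%:H - I * y%:H) p10 - rsc p01 (u%:H - L * v%:H)
       + lsc (x%:H - I * y%:H) (rsc p11 (u%:H - L * v%:H)))
    = qee + qeo * L + I * (qoe + qoo * L).
  rewrite !(eD, eN, eL, eR) /qee /qoe /qeo /qoo.
  move: (e p00) (e p10) (e p01) (e p11) => t1 t2 t3 t4.
  rewrite !(qrealC _ I) !(qrealC _ L) -!qscaleE.
  by apply: quatP => /=; ring.
clearbody wee woe weo woo qee qoe qeo qoo.
rewrite -S1 -S2 -S3 -S4 !(eD, eN, eX, eL, eR) Eee Eoe Eeo Eoo -!qscaleE.
clearbody a b c d; move: (e J) => t.
by apply: quatP => /=; ring.
Qed.

End Entries.

Lemma mx_bilinear_entry (R : realType) m n i j :
  bilinear_entry (fun a (N : 'M[quat R]_(m, n)) => a *: N) (@mxrscale R m n)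
    (fun N => N i j).
Proof. by split=> *; rewrite ?mxrscaleE ?mxE. Qed.

Lemma mulmx_row (R : realType) m (M h k : 'M[quat R]_m) (a c : R) (L : quat R) :
  M *m (a%:H *: h - c%:H *: k + mxrscale (a%:H *: k + c%:H *: h) L)
  = a%:H *: (M *m h) - c%:H *: (M *m k)
    + mxrscale (a%:H *: (M *m k) + c%:H *: (M *m h)) L.
Proof.
rewrite mulmxDr mulmxBr /mxrscale mulmxA (mulmxDr M).
by rewrite (mulmx_real M a h) (mulmx_real M c k) (mulmx_real M a k) (mulmx_real M c h).
Qed.

Lemma mulmx_signature (R : realType) m (J M g0 g1 : 'M[quat R]_m) (u n : R) :
  J *m J = 1%:M ->
  (M *m J) *m (J - u%:H *: g0 + n%:H *: g1)
  = M - u%:H *: (M *m (J *m g0)) + n%:H *: (M *m (J *m g1)).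
Proof.
move=> JJ; rewrite mulmxDr mulmxBr -(mulmxA M J J) JJ mulmx1.
by rewrite (mulmx_real _ u g0) (mulmx_real _ n g1) !mulmxA.
Qed.

Section KernelFormula.
Variables (R : realType) (V : rqInnerType R) (m : nat).
Variables (A As : V -> V) (C : qvec R m -> V) (Cs : V -> qvec R m) (J : 'M[quat R]_m).
Hypotheses (A_bounded : bounded_operator A) (C_bounded : bounded_operator C).
Hypotheses (A_adj : adjoint_of A As) (C_adj : adjoint_of C Cs).
Hypotheses (J_adj : mxadj J = J) (J_sqr : J *m J = 1%:M).
Hypothesis A_col : forall v, A v + As v = - C (J *m Cs v).

Definition resolvent_coef0 p := mx_of_op (fun c => Cs (op_inv (spencil A p) (C c))).
Definition resolvent_coef1 p := mx_of_op (fun c => Cs (A (op_inv (spencil A p) (C c)))).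

Local Notation F0 := resolvent_coef0.
Local Notation F1 := resolvent_coef1.
Local Notation S := (char_fun A C Cs J).

Let F0_conj p : F0 (qconj p) = F0 p. Proof. by rewrite /F0 spencil_conj. Qed.
Let F1_conj p : F1 (qconj p) = F1 p. Proof. by rewrite /F1 spencil_conj. Qed.

Lemma char_funE p :
  S p = 1%:M - p *: (F0 p *m J) + (`|p| ^+ 2)%:H *: (F1 p *m J).
Proof.
rewrite /char_fun /star_resolvent -/(F0 p) -/(F1 p) mulmxBl -scalemxAl.
by rewrite scalerBr scalerA qmulqc opprB addrA addrAC.
Qed.

Lemma char_fun_parts p :
  even_part S p
    = 1%:M - (qre p)%:H *: (F0 p *m J) + (`|p| ^+ 2)%:H *: (F1 p *m J) /\
  lodd_part S p = - ((im_abs p)%:H *: (F0 p *m J)).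
Proof.
apply: left_parts.
- rewrite char_funE {1}[p]polar scalerDl opprD scalerN scalerA.
  by rewrite (addrA 1%:M) [LHS]addrAC.
- rewrite char_funE F0_conj F1_conj qnorm_conj {1}[qconj p]polar.
  rewrite im_dir_conj im_abs_conj mulNr scalerDl scaleNr opprD opprK scalerN opprK.
  by rewrite scalerA (addrA 1%:M) [LHS]addrAC.
- by rewrite !scalerN im_dir2_abs.
Qed.

Lemma char_fun_adj q :
  J *m mxadj (S q) = J - mxrscale (mxadj (F0 q)) (qconj q)
                       + (`|q| ^+ 2)%:H *: mxadj (F1 q).
Proof.
rewrite char_funE; move: (F0 q) (F1 q) => M N.
have JJ (K : 'M[quat R]_m) : J *m (J *m K) = K by rewrite mulmxA J_sqr mul1mx.
rewrite mxadjD mxadjB mxadj1 (mxadj_scale (M *m J)) (mxadj_scale (N *m J)).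
rewrite (mxadjM M) (mxadjM N) J_adj qconj_real mxrscale_real mulmxDr mulmxBr mulmx1.
by rewrite mulmx_real JJ /mxrscale mulmxA JJ.
Qed.

Lemma char_fun_adj_parts q (H := fun q' => J *m mxadj (S (qconj q'))) :
  even_part H (qconj q)
    = J - (qre q)%:H *: mxadj (F0 q) + (`|q| ^+ 2)%:H *: mxadj (F1 q) /\
  rodd_part H (qconj q) = - ((im_abs q)%:H *: mxadj (F0 q)).
Proof.
have qE : qconj q = (qre q)%:H + im_dir (qconj q) * (im_abs q)%:H.
  by rewrite {1}[qconj q]polar im_abs_conj.
have LL := im_dir_abs (qconj q); rewrite im_abs_conj in LL.
rewrite /H; apply: right_parts; rewrite ?qconjK.
- rewrite char_fun_adj {1}qE; move: (mxadj (F0 q)) (mxadj (F1 q)) => M0 M1.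
  apply/matrixP => i j; rewrite !(mxrscaleE, mxE).
  move: (im_dir _) (M0 i j) => L f.
  by apply: quatP => /=; ring.
- rewrite char_fun_adj F0_conj F1_conj qnorm_conj qconjK.
  move: (mxadj (F0 q)) (mxadj (F1 q)) => M0 M1.
  have E : q = (qre q)%:H - im_dir (qconj q) * (im_abs q)%:H.
    by rewrite {1}[q]polar im_dir_conj mulNr opprK.
  rewrite [X in mxrscale M0 X]E; apply/matrixP => i j.
  rewrite !(mxrscaleE, mxE); move: (im_dir _) (M0 i j) => L f.
  by apply: quatP => /=; ring.
- move: (mxadj (F0 q)) => M0; apply/matrixP => i j; rewrite !(mxrscaleE, mxE).
  have -> (f : quat R) L : - ((im_abs q)%:H * f) * L * L = - (f * (L * L * (im_abs q)%:H)).
    by apply: quatP => /=; ring.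
  by rewrite LL mulrN !opprK qrealC.
Qed.

Variables (p q : quat R) (Bs : V -> V).
Hypotheses (p_dom : boundedly_invertible (spencil A p)).
Hypotheses (q_dom : boundedly_invertible (spencil A q)).
Hypothesis Bs_adj : adjoint_of (op_inv (spencil A q)) Bs.
Local Notation B := (op_inv (spencil A p)).

(** The blocks [C^* A^i B_p B_q^* A^{*j} C]; every product that occurs in the
    kernel is a real combination of them. *)
Definition kernel_block i j :=
  mx_of_op (fun c => Cs (iter i A (B (Bs (iter j As (C c)))))).
Local Notation P := kernel_block.

Let rA := A_bounded.1.
Let rC := C_bounded.1.
Let rCs := adjoint_rlin C_adj.
Let rBs := adjoint_rlin Bs_adj.

Let rB : right_linear B. Proof. by case: (op_inv_spec p_dom) => -[]. Qed.

Let B_comm v : A (B v) = B (A v).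
Proof.
have [_ BK KB] := op_inv_spec p_dom.
by rewrite -[RHS](congr1 B (congr1 A (KB v))) spencil_comm// BK.
Qed.

Let Bs_right v : Bs (spencil As q v) = v.
Proof.
have [_ BK KB] := op_inv_spec q_dom; apply: qdot_ext => u.
by rewrite -Bs_adj -(spencil_adjoint q A_adj) KB.
Qed.

Let Bs_comm v : As (Bs v) = Bs (As v).
Proof.
have [_ BK KB] := op_inv_spec q_dom; apply: qdot_ext => u.
rewrite -A_adj -!Bs_adj -A_adj; congr (qdot _ v).
by rewrite -[LHS](congr1 (op_inv _) (congr1 A (KB u))) spencil_comm// BK.
Qed.

Let op_ext (T T' : qvec R m -> qvec R m) : T =1 T' -> mx_of_op T = mx_of_op T'.
Proof. by move=> TT; apply/matrixP => i j; rewrite !mxE TT. Qed.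

Let B_left v : B v - (2 * qre p) *: A (B v) + `|p| ^+ 2 *: A (A (B v)) = v.
Proof. by have [_ _ KB] := op_inv_spec p_dom; exact: KB. Qed.

Let Bs_left v :
  v = Bs v - (2 * qre q) *: Bs (As v) + `|q| ^+ 2 *: Bs (As (As v)).
Proof.
by rewrite -!(rlin_scale rBs) -(rlin_sub rBs) -(rlin_add rBs); rewrite [RHS]Bs_right.
Qed.

Let combo (x y : R) (T0 T1 T2 : qvec R m -> qvec R m) :
  mx_of_op (fun c => T0 c - x *: T1 c + y *: T2 c) =
  mx_of_op T0 - x%:H *: mx_of_op T1 + y%:H *: mx_of_op T2.
Proof. by rewrite !mx_of_opD mx_of_opN !mx_of_opZ. Qed.

(** Inserting [B_q^* T_q^* = 1] between [B_p] and [C]. *)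
Let left_expand i :
  mx_of_op (fun c => Cs (iter i A (B (C c)))) =
  P i 0 - (2 * qre q)%:H *: P i 1 + (`|q| ^+ 2)%:H *: P i 2.
Proof.
rewrite -combo; apply: op_ext => c; have rAi := rlin_iter i rA.
rewrite [in LHS](Bs_left (C c)) (rlin_add rB) (rlin_sub rB) !(rlin_scale rB).
rewrite (rlin_add rAi) (rlin_sub rAi) !(rlin_scale rAi).
by rewrite (rlin_add rCs) (rlin_sub rCs) !(rlin_scale rCs).
Qed.

(** Inserting [T_p B_p = 1] between [C^*] and [B_q^*]. *)
Let right_expand j :
  mx_of_op (fun c => Cs (Bs (iter j As (C c)))) =
  P 0 j - (2 * qre p)%:H *: P 1 j + (`|p| ^+ 2)%:H *: P 2 j.
Proof.
rewrite -combo; apply: op_ext => c; rewrite -[in LHS](B_left (Bs _)).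
by rewrite (rlin_add rCs) (rlin_sub rCs) !(rlin_scale rCs).
Qed.

Lemma F0_expand : F0 p = P 0 0 - (2 * qre q)%:H *: P 0 1 + (`|q| ^+ 2)%:H *: P 0 2.
Proof. exact: (left_expand 0). Qed.

Lemma F1_expand : F1 p = P 1 0 - (2 * qre q)%:H *: P 1 1 + (`|q| ^+ 2)%:H *: P 1 2.
Proof. exact: (left_expand 1). Qed.

Let F0_adj : mxadj (F0 q) = mx_of_op (fun c => Cs (Bs (C c))).
Proof.
apply: (mxadj_of_op (Ts := Cs \o (Bs \o C))).
exact: (adjoint_comp (adjoint_sym C_adj) (adjoint_comp Bs_adj C_adj)).
Qed.

Let F1_adj : mxadj (F1 q) = mx_of_op (fun c => Cs (Bs (As (C c)))).
Proof.
apply: (mxadj_of_op (Ts := Cs \o (Bs \o (As \o C)))).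
exact: (adjoint_comp (adjoint_sym C_adj)
         (adjoint_comp A_adj (adjoint_comp Bs_adj C_adj))).
Qed.

Lemma F0_adj_expand :
  mxadj (F0 q) = P 0 0 - (2 * qre p)%:H *: P 1 0 + (`|p| ^+ 2)%:H *: P 2 0.
Proof. by rewrite F0_adj; exact: (right_expand 0). Qed.

Lemma F1_adj_expand :
  mxadj (F1 q) = P 0 1 - (2 * qre p)%:H *: P 1 1 + (`|p| ^+ 2)%:H *: P 2 1.
Proof. by rewrite F1_adj; exact: (right_expand 1). Qed.

(** The colligation identity [C J C^* = - (A + A^* )] collapses the product of two
    resolvent coefficients. *)
Let collapse i j :
  mx_of_op (fun c => Cs (iter i A (B (C c)))) *m
    (J *m mx_of_op (fun c => Cs (Bs (iter j As (C c))))) =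
  - (P i.+1 j + P i j.+1).
Proof.
have rAi := rlin_iter i rA.
rewrite -[X in X *m mx_of_op _]mx_of_mulmx mx_of_op_comp; last exact: mulmx_right_linear.
rewrite mx_of_op_comp; last exact: (rlin_comp rCs (rlin_comp rAi (rlin_comp rB rC))).
rewrite -mx_of_opD -mx_of_opN; apply: op_ext => c /=.
rewrite -Bs_comm; set v := Bs _.
have -> : C (J *m Cs v) = - (A v + As v) by rewrite A_col opprK.
rewrite (rlin_opp rB) (rlin_opp rAi) (rlin_opp rCs); congr (- _).
by rewrite (rlin_add rB) (rlin_add rAi) (rlin_add rCs) -B_comm -iterSr iterS.
Qed.

Lemma FJF :
  [/\ F0 p *m (J *m mxadj (F0 q)) = - (P 1 0 + P 0 1),
      F0 p *m (J *m mxadj (F1 q)) = - (P 1 1 + P 0 2),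
      F1 p *m (J *m mxadj (F0 q)) = - (P 2 0 + P 1 1)
    & F1 p *m (J *m mxadj (F1 q)) = - (P 2 1 + P 1 2)].
Proof.
rewrite F0_adj F1_adj.
by split; [exact: (collapse 0 0)|exact: (collapse 0 1)
          |exact: (collapse 1 0)|exact: (collapse 1 1)].
Qed.

Local Notation x := (qre p).
Local Notation y := (im_abs p).
Local Notation u := (qre q).
Local Notation v := (im_abs q).
Local Notation I := (im_dir p).
Local Notation L := (im_dir (qconj q)).
Hypotheses (p_pos : 0 < qre p) (q_pos : 0 < qre q).

Let H q' := J *m mxadj (S (qconj q')).
Let He := even_part H (qconj q).
Let Ho := rodd_part H (qconj q).

(** Stated for any [p'], since the left parts at [p] need the values at [p] and at
    [conj p]. *)
Let rstar_at p' : 0 < qre p' ->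
  let s := qre p' + u in let t := im_abs p' in
  let e := (kee s t v)%:H + im_dir p' * (koe s t v)%:H in
  let o := (keo s t v)%:H + im_dir p' * (koo s t v)%:H in
  rstar (fun q' => (kker p' (qconj q'))%:M) H (qconj q)
  = e *: He - o *: Ho + mxrscale (e *: Ho + o *: He) L.
Proof.
move=> p'_pos s t e o; have s0 : 0 < s by rewrite addr_gt0.
pose f q' : 'M[quat R]_m := (kker p' (qconj q'))%:M.
have rscM (z : quat R) : mxrscale (z%:M : 'M[quat R]_m) L = (z * L)%:M.
  by rewrite /mxrscale -scalar_mxM.
have [fe fo] : even_part f (qconj q) = e%:M /\ rodd_part f (qconj q) = o%:M.
  apply: right_parts; rewrite ?rscM /f ?qconjK.
  - by rewrite kker_split// -(raddfD scalar_mx).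
  - rewrite kker_split// im_abs_conj qconjK -(raddfB scalar_mx) -/s -/t -/e -/o.
    by rewrite -[in LHS](qconjK q) im_dir_conj mulrN.
  (* the coefficient [o] is a multiple of [v], and vanishes with [L] *)
  pose o1 := (t ^+ 2 - s ^+ 2 - v ^+ 2) / kden s t v.
  pose o2 := 2 * t * s / kden s t v.
  have oE : o = (o1%:H + im_dir p' * o2%:H) * v%:H.
    rewrite mulrDl -mulrA -!qrealM /o; congr (_%:H + _ * _%:H).
      by rewrite /keo /o1; ring.
    by rewrite /koo /o2; ring.
  have LL := im_dir_abs (qconj q); rewrite im_abs_conj in LL.
  rewrite -(raddfN scalar_mx) oE; congr scalar_mx.
  by rewrite -!mulrA -(qrealC v (L * L)) LL mulrN.
by rewrite /rstar -/f fe fo -/He -/Ho !mul_scalar_mx.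
Qed.

Local Notation a := (kee (x + u) y v).
Local Notation b := (koe (x + u) y v).
Local Notation c := (keo (x + u) y v).
Local Notation d := (koo (x + u) y v).

Let s_pos : 0 < x + u. Proof. by rewrite addr_gt0. Qed.

Let II_b k : I * (I * (b%:H * k)) = - (b%:H * k).
Proof.
have -> : b = y * (- ((x + u) ^+ 2 + y ^+ 2 - v ^+ 2) / kden (x + u) y v).
  by rewrite /koe; ring.
by rewrite qrealM !mulrA im_dir_abs !mulNr.
Qed.

Let II_d k : I * (I * (d%:H * k)) = - (d%:H * k).
Proof.
have -> : d = y * (2 * (x + u) * v / kden (x + u) y v) by rewrite /koo; ring.
by rewrite qrealM !mulrA im_dir_abs !mulNr.
Qed.

Let kker_parts (f := fun p' => (kker p' q)%:M : 'M[quat R]_m) :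
  even_part f p = (a%:H + c%:H * L)%:M /\ lodd_part f p = (b%:H + d%:H * L)%:M.
Proof.
rewrite /f; apply: left_parts.
- rewrite kker_split// scale_scalar_mx -(raddfD scalar_mx); congr scalar_mx.
  by rewrite mulrDl mulrDr !mulrA addrACA.
- rewrite kker_split// im_dir_conj im_abs_conj scale_scalar_mx -(raddfB scalar_mx).
  congr scalar_mx; rewrite !mulNr mulrBl mulrDr opprD !mulrA.
  by rewrite addrACA.
rewrite !scale_scalar_mx -(raddfN scalar_mx); congr scalar_mx.
by rewrite !mulrDr II_d -[b%:H]mulr1 II_b opprD.
Qed.

Let G p' := rstar (fun q' => (kker p' (qconj q'))%:M) H (qconj q).

Let G_parts :
  even_part G p = a%:H *: He - c%:H *: Ho + mxrscale (a%:H *: Ho + c%:H *: He) L /\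
  lodd_part G p = b%:H *: He - d%:H *: Ho + mxrscale (b%:H *: Ho + d%:H *: He) L.
Proof.
apply: left_parts; rewrite /G.
- rewrite rstar_at//; apply/matrixP => i j.
  exact: (split_entry (mx_bilinear_entry _ i j)).
- rewrite -(scaleNr I) -(im_dir_conj p) rstar_at// im_abs_conj; apply/matrixP => i j.
  exact: (split_entry (mx_bilinear_entry _ i j)).
apply/matrixP => i j.
exact: (square_entry (mx_bilinear_entry _ i j)).
Qed.

(** At real points the right-hand side is
    [C^* (1 - x A) B_x B_y^* (1 - y A^* ) C = C^* (1 - x A)^-1 (1 - y A^* )^-1 C]. *)
Lemma schur_kernel_formula :
  schur_kernel J S p q =
  P 0 0 - qconj p *: P 1 0 - mxrscale (P 0 1) q + qconj p *: mxrscale (P 1 1) q.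
Proof.
have [kk1 kk2] := kker_parts; have [G1 G2] := G_parts.
have J1 : even_part (fun=> J) p = J by exact: half_double.
have J2 : lodd_part (fun=> J) p = 0.
  by rewrite /lodd_part subrr !scaler0.
rewrite /schur_kernel /star kk1 kk2 J1 J2 -/H -/G G1 G2 !mul0mx subr0 addr0.
rewrite -[J *m (_ + c%:H * L)%:M]/(mxrscale J _).
rewrite -[J *m (_ + d%:H * L)%:M]/(mxrscale J _).
rewrite (mulmx_row (even_part S p) He Ho a c) (mulmx_row (even_part S p) He Ho b d).
rewrite (mulmx_row (lodd_part S p) He Ho a c) (mulmx_row (lodd_part S p) He Ho b d).
have -> : P 0 0 - qconj p *: P 1 0 - mxrscale (P 0 1) q + qconj p *: mxrscale (P 1 1) q
  = P 0 0 - (x%:H - I * y%:H) *: P 1 0 - mxrscale (P 0 1) (u%:H - L * v%:H)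
    + (x%:H - I * y%:H) *: mxrscale (P 1 1) (u%:H - L * v%:H).
  have <- : qconj p = x%:H - I * y%:H.
    by rewrite {1}[qconj p]polar im_dir_conj im_abs_conj mulNr.
  have <- // : q = u%:H - L * v%:H.
  by rewrite {1}[q]polar im_dir_conj mulNr opprK.
have [X00 X01 X10 X11] := FJF.
have [SeE SoE] := char_fun_parts p; have [HeE HoE] := char_fun_adj_parts q.
have F0E := F0_expand; have F1E := F1_expand.
have G0E := F0_adj_expand; have G1E := F1_adj_expand.
rewrite (qnorm2_polar q) in F0E F1E HeE; rewrite (qnorm2_polar p) in G0E G1E SeE.
apply/matrixP => i j.
apply: (kernel_entry (mx_bilinear_entry _ i j) F0E F1E G0E G1E X00 X01 X10 X11
  _ _ _ _ _ _ s_pos).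
- rewrite SeE /He HeE mulmxDl mulmxBl mul1mx -!scalemxAl.
  rewrite (mulmx_signature (F0 p)) ?(mulmx_signature (F1 p))//.
  by rewrite !scalerDr !scalerN.
- rewrite SoE /He HeE mulNmx -scalemxAl mulmx_signature//.
  by rewrite scalerDr scalerBr.
- rewrite SeE /Ho HoE mulmxN mulmxDl mulmxBl mul1mx -!scalemxAl.
  rewrite (mulmx_real (F0 p *m J)) (mulmx_real (F1 p *m J)) -!mulmxA.
  by rewrite opprD (opprD (v%:H *: _)) opprK.
- by rewrite SoE /Ho HoE mulmxN mulNmx opprK -scalemxAl mulmx_real -mulmxA.
Qed.

End KernelFormula.

(** * Positivity and the main theorem *)

Section Positivity.
Variable R : realType.

Lemma gram_nonneg (V : rqInnerType R) n (t : 'I_n -> V) :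
  nonneg_mx (\matrix_(i, j) qdot (t j) (t i)).
Proof.
split; first by apply/matrixP => i j; rewrite !mxE -qdotC.
move=> z; set w := \sum_i t i :* z i 0.
have -> : (mxadj z *m (\matrix_(i, j) qdot (t j) (t i)) *m z) 0 0 = qdot w w.
  rewrite mxE {1}/w qdot_suml; apply: eq_bigr => j _.
  rewrite qdotZl mxE; congr (_ * _); rewrite qdot_sumr; apply: eq_bigr => i _.
  by rewrite qdotZr !mxE.
by rewrite qdot_norm sqr_ge0.
Qed.

Lemma qdot_qvecE m (c d : qvec R m) : qdot c d = (mxadj d *m c) 0 0.
Proof. by []. Qed.

Variables (V : rqInnerType R) (m : nat).
Variables (A As : V -> V) (C : qvec R m -> V) (Cs : V -> qvec R m) (J : 'M[quat R]_m).
Hypotheses (A_bounded : bounded_operator A) (C_bounded : bounded_operator C).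
Hypotheses (A_adj : adjoint_of A As) (C_adj : adjoint_of C Cs).
Hypotheses (J_sign : real_signature_mx J).
Hypothesis A_col : forall v, A v + As v = - C (J *m Cs v).

(** [T(q)^* d] for [T(p) = (C^* - conj(p) C^* A) B_p]. *)
Definition kernel_vector (Bs : V -> V) (q : quat R) (d : 'cV[quat R]_m) : V :=
  Bs (C d - As (C (q *: d))).

(** The kernel factors as [T(p) T(q)^*], so sandwiching it between [c^*] and [d]
    gives an inner product of kernel vectors. *)
Lemma schur_kernel_gram p q Bp Bq c d : 0 < qre p -> 0 < qre q ->
  boundedly_invertible (spencil A p) -> boundedly_invertible (spencil A q) ->
  adjoint_of (op_inv (spencil A p)) Bp -> adjoint_of (op_inv (spencil A q)) Bq ->
  (mxadj c *m schur_kernel J (char_fun A C Cs J) p q *m d) 0 0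
  = qdot (kernel_vector Bq q d) (kernel_vector Bp p c).
Proof.
move=> p0 q0 ip iq aBp aBq.
have J_adj := real_signature_adj J_sign; have J_sqr := real_signature_sqr J_sign.
rewrite (schur_kernel_formula A_bounded C_bounded A_adj C_adj J_adj J_sqr A_col
  ip iq aBq p0 q0).
have [[rB _] _ _] := op_inv_spec ip.
have rA := A_bounded.1; have rCs := adjoint_rlin C_adj.
pose T i u := Cs (iter i A (op_inv (spencil A p) (Bq u))).
have rT i : right_linear (T i).
  exact: (rlin_comp rCs (rlin_comp (rlin_iter i rA) (rlin_comp rB (adjoint_rlin aBq)))).
have PE i j (e : 'cV[quat R]_m) :
    kernel_block A As C Cs p Bq i j *m e = T i (iter j As (C e)).
  rewrite -(mx_of_opE e (T := fun e => T i (iter j As (C e))))//.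
  apply: (rlin_comp (rT i)).
  exact: (rlin_comp (rlin_iter j (adjoint_rlin A_adj)) C_bounded.1).
rewrite /kernel_vector -aBp qdotDr qdotNr -!(adjoint_sym C_adj) -(A_adj _ (C _)).
rewrite -(adjoint_sym C_adj) -[Cs (op_inv _ _)]/(T 0 _) -[Cs (A _)]/(T 1 _).
rewrite !(rlin_sub (rT _)) -[C d]/(iter 0 As (C d)) -[As (C _)]/(iter 1 As (C _)).
rewrite -!PE; move: (kernel_block _ _ _ _ _ _ 0 0) (kernel_block _ _ _ _ _ _ 1 0).
move: (kernel_block _ _ _ _ _ _ 0 1) (kernel_block _ _ _ _ _ _ 1 1) => p01 p11 p00 p10.
rewrite !qdot_qvecE mxadj_scale -mulmxA.
have entry (M N : 'M[quat R]_1) : (M - N) 0 0 = M 0 0 - N 0 0 by rewrite !mxE.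
rewrite -entry; congr fun_of_matrix.
have -> : mxrscale (mxadj c) (qconj p) *m (p10 *m d - p11 *m (q *: d))
    = mxadj c *m (qconj p *: (p10 *m d - p11 *m (q *: d))).
  by rewrite /mxrscale -mulmxA mul_scalar_mx.
rewrite -mulmxBr; congr (_ *m _); rewrite scalerBr opprB addrA.
rewrite mulmxDl mulmxBl mulmxBl /mxrscale -!scalemxAl -!mulmxA !mul_scalar_mx.
by rewrite [RHS]addrAC; congr (_ + _); rewrite addrAC.
Qed.

End Positivity.

Theorem theorem7p8 (R : realType) (V : rqHilbertType R) (m : nat)
  (A As : V -> V) (C : qvec R m -> V) (Cs : V -> qvec R m) (J : 'M[quat R]_m)
  (A_bounded : bounded_operator A) (A_adj : adjoint_of A As)
  (A_rank : has_rank (fun v => A v + As v) m)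
  (J_sign : real_signature_mx J)
  (C_bounded : bounded_operator C) (C_adj : adjoint_of C Cs)
  (A_col : forall v, A v + As v = - C (J *m Cs v))
  (CA_obs : observable Cs A) :
  in_S0 J (char_fun_dom A) (char_fun A C Cs J).
Proof.
split.
  have [e e0 inv] := spencil_invertible_near0 A_bounded.
  exists (half_ball e); split; first exact: half_ball_s_domain.
  by move=> p [_ pe]; exact: inv.
move=> Omega [[[oO _ _] _ _] _ Ore _] OD; split.
  apply: char_fun_slice => //; first exact: C_bounded.1.
  exact: adjoint_bop C_bounded C_adj.
move=> n w c Ow.
have adj i : exists Bs, adjoint_of (op_inv (spencil A (w i))) Bs.
  have [bB BK KB] := op_inv_spec (OD _ (Ow i)).
  exact: (adjoint_inverse (spencil_bounded A_bounded (w i))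
    (spencil_adjoint (w i) A_adj) bB KB BK).
have [Bs Bs_adj] := choice adj.
set M := \matrix_(i, j) _.
have -> : M = \matrix_(i, j) qdot (kernel_vector As C (Bs j) (w j) (c j))
                                  (kernel_vector As C (Bs i) (w i) (c i)).
  apply/matrixP => i j; rewrite [LHS]mxE [RHS]mxE.
  apply: (schur_kernel_gram A_bounded C_bounded A_adj C_adj J_sign A_col).
  - exact: Ore.
  - exact: Ore.
  - exact: OD.
  - exact: OD.
  - exact: Bs_adj.
  - exact: Bs_adj.
exact: gram_nonneg.
Qed.
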